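(* Let $\mathcal{H}_0$ be a separable Hilbert space and let $(X_t)_{t\in\mathbb{Z}}$ be an $\mathcal{H}_0$-valued ergodic stationary process defined on a probability space $(\Omega,\mathcal{F},\mathbb{P})$ and satisfying $\mathbb{E}\big[\|X_0\|_{\mathcal{H}_0}^2\big]<\infty$. Define, for all $n\ge1$ and $1\le k\le n$, $$X^c_{n,k}=X_k-\frac1n\sum_{j=1}^nX_j .$$ Then, for all $h\in\mathbb{Z}$, $$\lim_{n\to\infty}\frac1n\sum_{\substack{1\le k,k'\le n\\ k-k'=h}}X^c_{n,k}\otimes X^c_{n,k'}=\mathrm{Cov}(X_h,X_0)\quad\text{in }\mathcal{S}_1(\mathcal{H}_0),\quad\mathbb{P}\text{-a.s.},$$ where $\mathcal{S}_1(\mathcal{H}_0)$ is the space of trace-class operators on $\mathcal{H}_0$ endowed with the trace-norm.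
   Context: Hilbert spaces are complex, with inner product linear in the first argument. For $x,y\in\mathcal{H}_0$, $x\otimes y$ is the rank-one operator $z\mapsto\langle z,y\rangle_{\mathcal{H}_0}\,x$. For $X,Y\in L^2(\Omega,\mathcal{F},\mathcal{H}_0,\mathbb{P})$, $\mathrm{Cov}(X,Y)$ is the unique bounded operator on $\mathcal{H}_0$ with $\langle \mathrm{Cov}(X,Y)y,x\rangle=\mathrm{Cov}(\langle X,x\rangle,\langle Y,y\rangle)$ for all $x,y\in\mathcal{H}_0$, where $\mathrm{Cov}(U,V)=\mathbb{E}[(U-\mathbb{E}U)\overline{(V-\mathbb{E}V)}]$ for complex random variables. Stationary means strictly stationary; ergodic means that the shift on $\mathcal{H}_0^{\mathbb{Z}}$ endowed with the law of the process is an ergodic measure-preserving system. *)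

(* Defs.v *)
From HB Require Import structures.
From mathcomp Require Import all_boot all_order all_algebra.
From mathcomp Require Import all_classical all_reals all_analysis.
From mathcomp Require Export complex.

Set Implicit Arguments.
Unset Strict Implicit.
Unset Printing Implicit Defensive.

Import Order.TTheory GRing.Theory Num.Theory.
Import numFieldNormedType.Exports.

Local Open Scope classical_set_scope.
Local Open Scope ring_scope.
Local Open Scope complex_scope.

HB.mixin Record CompleteNormedModule_isHilbert (R : realType) (H : Type)
    of CompleteNormedModule R[i] H := {
  ip : H -> H -> R[i] ;
  ip_linearl : forall (a : R[i]) (x y z : H),
    ip (a *: x + y) z = a * ip x z + ip y z ;
  ip_conjC : forall x y : H, ip y x = Num.conj (ip x y) ;
  ip_normE : forall x : H, ip x x = `|x| ^+ 2
}.

#[short(type="hilbertType")]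
HB.structure Definition Hilbert (R : realType) :=
  { H of CompleteNormedModule R[i] H & CompleteNormedModule_isHilbert R H }.

(* Norms on a module over R[i] take their values in R[i]; this is the same
   number in R. *)
Definition rnorm (R : realType) (H : hilbertType R) (x : H) : R :=
  complex.Re `|x|.

Definition separable (E : topologicalType) : Prop :=
  exists2 D : set E, countable D & dense D.

Section Operators.
Context {R : realType} {H : hilbertType R}.
Implicit Types (x y z e : H) (S T P : H -> H) (E : set H).

Definition bounded_op T : Prop :=
  linear T /\ exists M : R, forall x, rnorm (T x) <= M * rnorm x.

Definition rank_one x y : H -> H := fun z => ip z y *: x.

Definition is_adjoint T S : Prop :=
  bounded_op S /\ forall x y, ip (T x) y = ip x (S y).

(* The order of R[i] makes 0 <= c mean that c is real and nonnegative. *)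
Definition positive_op P : Prop := bounded_op P /\ forall x, 0 <= ip (P x) x.

Definition is_abs_op T P : Prop :=
  positive_op P /\ exists2 S, is_adjoint T S & P \o P = S \o T.

Definition abs_op T : H -> H := xget 0 (is_abs_op T).

Definition orthonormal E : Prop :=
  (forall e, E e -> ip e e = 1) /\
  (forall e f, E e -> E f -> e != f -> ip e f = 0).

Definition hilbert_basis E : Prop :=
  orthonormal E /\ forall x, (forall e, E e -> ip x e = 0) -> x = 0.

Lemma ex_hilbert_basis : exists E, hilbert_basis E.
Proof.
have ipZl a x y : ip (a *: x) y = a * ip x y.
  have ip0 : ip 0 y = 0.
    by have /eqP := ip_linearl 1 0 0 y; rewrite scaler0 addr0 mul1r addrC -subr_eq subrr eq_sym => /eqP.
  by rewrite -[a *: x]addr0 ip_linearl ip0 addr0.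
have [F Fon Ftot|E [onE maxE]] := @Zorn_bigcup H orthonormal.
  split=> [e [A FA Ae]|e f [A FA Ae] [B FB Bf]]; first exact: (Fon _ FA).1.
  have [AB|BA] := Ftot _ _ FA FB.
  - by apply: (Fon _ FB).2 => //; exact: AB.
  - by apply: (Fon _ FA).2 => //; exact: BA.
exists E; split=> // x xE; apply: contrapT => /eqP x0.
have nx0 : `|x| != 0 by rewrite normr_eq0.
pose e := `|x|^-1 *: x.
have eE f : E f -> ip e f = 0 by move=> Ef; rewrite ipZl xE ?mulr0.
have ee : ip e e = 1.
  by rewrite ip_normE normrZ normfV normr_id mulVf ?expr1n.
have nEe : ~ E e by move=> /eE; rewrite ee => /eqP; rewrite oner_eq0.
apply: (maxE (E `|` [set e])).
  by split=> [f Ef|/(_ e (or_intror erefl))//]; left.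
split=> [f [/onE.1//|->//]|f g [Ef|->] [Eg|->] fg].
- exact: onE.2.
- by rewrite ip_conjC eE// rmorph0.
- exact: eE.
- by rewrite eqxx in fg.
Qed.

(* Trace of a positive operator, computed in one chosen basis: its value does
   not depend on that choice. *)
Definition trace P : \bar R :=
  \esum_(e in xget set0 hilbert_basis) (complex.Re (ip (P e) e))%:E.

(* The clause on abs_op only rules out the default value of xget. *)
Definition trace_class T : Prop :=
  [/\ bounded_op T, is_abs_op T (abs_op T) & (trace (abs_op T) < +oo)%E].

Definition trace_norm T : \bar R :=
  if `[< trace_class T >] then trace (abs_op T) else +oo%E.

Definition cvg_S1 (T_ : nat -> H -> H) T : Prop :=
  [/\ forall n, trace_class (T_ n), trace_class T &
      trace_norm (T_ n - T) @[n --> \oo] --> 0%E].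

End Operators.

Section Probability.
Context {R : realType} {H : hilbertType R} {d : measure_display}
        {Omega : measurableType d} (P : probability Omega R).

Definition cexpectation (Z : Omega -> R[i]) : R[i] :=
  (\int[P]_w complex.Re (Z w)) +i* (\int[P]_w complex.Im (Z w)).

Definition ccovariance (U V : Omega -> R[i]) : R[i] :=
  cexpectation (fun w =>
    (U w - cexpectation U) * Num.conj (V w - cexpectation V)).

Definition is_cov_op (X Y : Omega -> H) (C : H -> H) : Prop :=
  bounded_op C /\
  forall x y, ip (C y) x =
    ccovariance (fun w => ip (X w) x) (fun w => ip (Y w) y).

Definition cov_op (X Y : Omega -> H) : H -> H := xget 0 (is_cov_op X Y).

End Probability.

Section Ergodicity.
Context {R : realType} {d : measure_display} {E : measurableType d}.

Definition measure_preserving (mu : set E -> \bar R) (S : E -> E) : Prop :=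
  measurable_fun setT S /\
  forall A, measurable A -> mu (S @^-1` A) = mu A.

Definition ergodic (mu : set E -> \bar R) (S : E -> E) : Prop :=
  measure_preserving mu S /\
  forall A, measurable A -> S @^-1` A = A -> mu A = 0%E \/ mu A = 1%E.

End Ergodicity.

Notation borelType H := (g_sigma_algebraType (@open H)).

Definition cylinders (R : realType) (H : hilbertType R) :
    set (set (int -> H)) :=
  [set C | exists t : int,
     exists2 B : set (borelType H), measurable B & C = [set x | B (x t)]].

Notation path_space H := (g_sigma_algebraType (@cylinders _ H)).

Section Processes.
Context {R : realType} {H : hilbertType R} {d : measure_display}
        {Omega : measurableType d} (P : probability Omega R).
Implicit Type X : int -> Omega -> H.

Definition is_process X : Prop :=
  forall t, measurable_fun setT (X t : Omega -> borelType H).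

Definition shift (x : path_space H) : path_space H := fun t : int => x (t + 1).

Definition law X : set (path_space H) -> \bar R :=
  pushforward P (fun w => (fun t => X t w) : path_space H).

Definition strictly_stationary X : Prop :=
  forall (s : int) (A : set (path_space H)), measurable A ->
    law (fun t => X (t + s)) A = law X A.

Definition ergodic_process X : Prop := ergodic (law X) shift.

Definition centered X (n k : nat) (w : Omega) : H :=
  X k%:Z w - n%:R^-1 *: \sum_(1 <= j < n.+1) X j%:Z w.

Definition empirical_autocov X (h : int) (n : nat) (w : Omega) : H -> H :=
  (n%:R^-1 : R[i]) *:
  \sum_(1 <= k < n.+1) \sum_(1 <= k' < n.+1 | k%:Z - k'%:Z == h)
     rank_one (centered X n k w) (centered X n k' w).

End Processes.

(* Main.v *)
(* The trace norm of an operator T is the supremum of the real functionals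
   T |-> sum_i Re <T e_i, f_i> over finite orthonormal families (e_i) and
   families (f_i) that are images of the e_i under a contraction.  Such
   functionals commute with weak integrals, so trace norm estimates reduce to
   scalar integral estimates; in particular x (x) y has norm at most |x| |y|.
   The lagged products (X_(k+a) - m) (x) (X_(k+b) - m), where m is the mean, are
   approximated, uniformly over these functionals and up to an error whose
   average is controlled by Birkhoff's theorem, by the products obtained after
   replacing X by a simple function of X that is close in L^2(H).  For the latter
   only finitely many scalar Birkhoff averages occur.  The same argument in H
   gives the convergence of the empirical mean, and recentering at the empirical
   mean perturbs the sum by a quantity tending to 0 in trace norm. *)
Require Import Defs.
From mathcomp Require Import all_boot all_order all_algebra.
From mathcomp Require Import all_classical all_reals all_analysis.
From mathcomp Require Import measurable_realfun finmap ring lra zify.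
Set Implicit Arguments.
Unset Strict Implicit.
Unset Printing Implicit Defensive.
Import Order.TTheory GRing.Theory Num.Theory.
Import numFieldNormedType.Exports.
Local Open Scope classical_set_scope.
Local Open Scope ring_scope.
Local Open Scope complex_scope.

(** * The real inner product *)

(** For a single functional, Birkhoff's theorem leaves a null set that depends on the functional,
    and the trace norm involves uncountably many of them. Simple functions make the null set common:
    it then depends only on finitely many scalar coefficients and on one error function. Working
    with functionals also replaces the triangle inequality for [trace_norm], which is awkward to
    obtain from absolute values: [nuclear_le] is additive by inspection, and a regularized polar
    decomposition converts it into a bound on the trace. The mean and the covariance are built from
    scalar integrals by a Riesz-type representation. Iterates of the shift reach nonnegative times
    only, so the lag is written [a - b] with natural [a] and [b], and stationarity moves
    expectations at the times [a - b] and [0] to the times [a] and [b]. *)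

Section InnerProduct.
Context {R : realType} {H : hilbertType R}.
Implicit Types (x y z : H) (a b : R[i]) (r s : R).

(** Estimates are carried out in [R] rather than in [R[i]]; nothing is lost because [Im_ip] turns
    imaginary parts into values of [rip]. *)
Definition rip x y : R := complex.Re (ip x y).

Lemma ip0l z : ip (0 : H) z = 0.
Proof.
have /eqP := ip_linearl 1 0 0 z.
by rewrite scaler0 addr0 mul1r addrC -subr_eq subrr eq_sym => /eqP.
Qed.

Lemma ipZl a x z : ip (a *: x) z = a * ip x z.
Proof. by rewrite -[a *: x]addr0 ip_linearl ip0l addr0. Qed.

Lemma ipDl x y z : ip (x + y) z = ip x z + ip y z.
Proof. by rewrite -[x in LHS]scale1r ip_linearl mul1r. Qed.

Lemma ipDr x y z : ip z (x + y) = ip z x + ip z y.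
Proof. by rewrite ip_conjC ipDl rmorphD/= -!ip_conjC. Qed.

Lemma ipZr a x z : ip z (a *: x) = Num.conj a * ip z x.
Proof. by rewrite ip_conjC ipZl rmorphM/= -ip_conjC. Qed.

Lemma ip0r z : ip z (0 : H) = 0.
Proof. by rewrite ip_conjC ip0l rmorph0. Qed.

Lemma cReD a b : complex.Re (a + b) = complex.Re a + complex.Re b.
Proof. by case: a; case: b. Qed.

Lemma cImD a b : complex.Im (a + b) = complex.Im a + complex.Im b.
Proof. by case: a; case: b. Qed.

Lemma cReN a : complex.Re (- a) = - complex.Re a.
Proof. by case: a. Qed.

Lemma cReM a b :
  complex.Re (a * b) = complex.Re a * complex.Re b - complex.Im a * complex.Im b.
Proof. by case: a; case: b. Qed.

Lemma cImM a b :
  complex.Im (a * b) = complex.Re a * complex.Im b + complex.Im a * complex.Re b.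
Proof. by case: a; case: b. Qed.

Lemma cReZ r a : complex.Re (r%:C * a) = r * complex.Re a.
Proof. by case: a => ? ? /=; rewrite mul0r subr0. Qed.

Lemma cImZ r a : complex.Im (r%:C * a) = r * complex.Im a.
Proof. by case: a => ? ? /=; rewrite mul0r addr0. Qed.

Lemma cRe_conj a : complex.Re (Num.conj a) = complex.Re a.
Proof. by case: a. Qed.

Lemma cIm_conj a : complex.Im (Num.conj a) = - complex.Im a.
Proof. by case: a. Qed.

Lemma conj_real r : Num.conj (r%:C) = r%:C.
Proof. exact: conjc_real. Qed.

Lemma ripC x y : rip x y = rip y x.
Proof. by rewrite /rip ip_conjC cRe_conj. Qed.

Lemma ripDl x y z : rip (x + y) z = rip x z + rip y z.
Proof. by rewrite /rip ipDl cReD. Qed.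

Lemma ripDr x y z : rip z (x + y) = rip z x + rip z y.
Proof. by rewrite /rip ipDr cReD. Qed.

Lemma ripZl r x y : rip (r%:C *: x) y = r * rip x y.
Proof. by rewrite /rip ipZl cReZ. Qed.

Lemma ripZr r x y : rip x (r%:C *: y) = r * rip x y.
Proof. by rewrite ripC ripZl ripC. Qed.

Lemma rip0l x : rip 0 x = 0. Proof. by rewrite /rip ip0l. Qed.

Lemma rip0r x : rip x 0 = 0. Proof. by rewrite /rip ip0r. Qed.

Lemma ripNl x y : rip (- x) y = - rip x y.
Proof. by rewrite -scaleN1r /rip ipZl mulN1r cReN. Qed.

Lemma ripNr x y : rip x (- y) = - rip x y.
Proof. by rewrite ripC ripNl ripC. Qed.

Lemma ripBl x y z : rip (x - y) z = rip x z - rip y z.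
Proof. by rewrite ripDl ripNl. Qed.

Lemma ripBr x y z : rip z (x - y) = rip z x - rip z y.
Proof. by rewrite ripDr ripNr. Qed.

Lemma rip_suml (I : Type) (s : seq I) (F : I -> H) z :
  rip (\sum_(i <- s) F i) z = \sum_(i <- s) rip (F i) z.
Proof.
by elim: s => [|i s IH]; rewrite ?big_nil ?rip0l// !big_cons ripDl IH.
Qed.

Lemma rip_sumr (I : Type) (s : seq I) (F : I -> H) z :
  rip z (\sum_(i <- s) F i) = \sum_(i <- s) rip z (F i).
Proof. by rewrite ripC rip_suml; apply: eq_bigr => i _; rewrite ripC. Qed.

Lemma Im_ip x y : complex.Im (ip x y) = rip x ('i%C *: y).
Proof.
rewrite /rip ipZr cReM cRe_conj cIm_conj/=.
by case: (ip x y) => a b /=; rewrite mul0r sub0r mulN1r opprK.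
Qed.

Lemma rnormE x : `|x| = (rnorm x)%:C.
Proof. by rewrite /rnorm RRe_real ?normr_real. Qed.

Lemma rnorm_ge0 x : 0 <= rnorm x.
Proof. by rewrite -ler0c -rnormE normr_ge0. Qed.

Lemma rnorm0 : rnorm (0 : H) = 0.
Proof. by rewrite /rnorm normr0. Qed.

Lemma rnorm_eq0 x : (rnorm x == 0) = (x == 0).
Proof.
rewrite -(normr_eq0 x) rnormE; apply/eqP/eqP => [->//|].
by move=> /complexI.
Qed.

Lemma rnormD x y : rnorm (x + y) <= rnorm x + rnorm y.
Proof. by rewrite -lecR rmorphD/= -!rnormE ler_normD. Qed.

Lemma rnormN x : rnorm (- x) = rnorm x.
Proof. by rewrite /rnorm normrN. Qed.

Lemma rnormB x y : rnorm (x - y) <= rnorm x + rnorm y.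
Proof. by rewrite -[rnorm y]rnormN rnormD. Qed.

Lemma rnorm_distC x y : rnorm (x - y) = rnorm (y - x).
Proof. by rewrite /rnorm distrC. Qed.

Lemma rnorm_distD z x y : rnorm (x - y) <= rnorm (x - z) + rnorm (z - y).
Proof. by rewrite -[x in leLHS](subrK z) -addrA rnormD. Qed.

Lemma normc_real r : `|r%:C| = (`|r|)%:C.
Proof. by rewrite normc_def/= expr0n/= addr0 sqrtr_sqr. Qed.

Lemma rnormZ r x : rnorm (r%:C *: x) = `|r| * rnorm x.
Proof. by rewrite /rnorm normrZ normc_real cReZ. Qed.

Lemma rnormMi x : rnorm ('i%C *: x) = rnorm x.
Proof. by rewrite /rnorm normrZ normc_def/= expr0n expr1n add0r sqrtr1 mul1r. Qed.

Lemma ipxx x : ip x x = (rnorm x ^+ 2)%:C.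
Proof. by rewrite ip_normE rnormE rmorphXn. Qed.

Lemma ripxx x : rip x x = rnorm x ^+ 2.
Proof. by rewrite /rip ipxx. Qed.

Lemma rnormD2 x y :
  rnorm (x + y) ^+ 2 = rnorm x ^+ 2 + 2 * rip x y + rnorm y ^+ 2.
Proof. by rewrite -!ripxx ripDl !ripDr (ripC y x); ring. Qed.

Lemma rnormB2 x y :
  rnorm (x - y) ^+ 2 = rnorm x ^+ 2 - 2 * rip x y + rnorm y ^+ 2.
Proof. by rewrite -!ripxx ripBl !ripBr (ripC y x); ring. Qed.

Lemma rip_le x y : rip x y <= rnorm x * rnorm y.
Proof.
have [/eqP|x0] := eqVneq (rnorm x) 0.
  by rewrite rnorm_eq0 => /eqP->; rewrite rip0l rnorm0 mul0r.
have [/eqP|y0] := eqVneq (rnorm y) 0.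
  by rewrite rnorm_eq0 => /eqP->; rewrite rip0r rnorm0 mulr0.
have xy0 : 0 < rnorm x * rnorm y by rewrite mulr_gt0// lt_neqAle eq_sym ?x0 ?y0 rnorm_ge0.
(* Cauchy-Schwarz: expand the square of [|y| x - |x| y] and divide by [2 |x| |y|]. *)
have := sqr_ge0 (rnorm ((rnorm y)%:C *: x - (rnorm x)%:C *: y)).
rewrite rnormB2 !rnormZ !ger0_norm ?rnorm_ge0// ripZl ripZr => h.
by rewrite -(ler_pM2l xy0); nra.
Qed.

Lemma rip_abs x y : `|rip x y| <= rnorm x * rnorm y.
Proof.
by rewrite ler_norml rip_le andbT lerNl -ripNl (le_trans (rip_le _ _))// rnormN.
Qed.

Lemma rip_eq x y : (forall z, rip z x = rip z y) -> x = y.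
Proof.
move=> h; apply/eqP; rewrite -subr_eq0 -rnorm_eq0 -sqrf_eq0.
by rewrite -ripxx ripBr h subrr.
Qed.

Lemma ip_eqr x y : (forall z, ip z x = ip z y) -> x = y.
Proof. by move=> h; apply: rip_eq => z; rewrite /rip h. Qed.

Lemma rnorm_cauchy (u : nat -> H) :
  (forall e, 0 < e -> exists N, forall m n, (N <= m)%N -> (N <= n)%N ->
     rnorm (u m - u n) < e) ->
  exists l, forall e, 0 < e -> exists N, forall n, (N <= n)%N -> rnorm (u n - l) < e.
Proof.
move=> hu.
have : cvg (u @ \oo).
  apply/cauchy_cvgP/cauchy_ballP => e e0.
  (* Balls have radii in [R[i]], but a positive element of [R[i]] is real. *)
  have eE : e = (complex.Re e)%:C by rewrite RRe_real// gtr0_real.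
  have [|N hN] := hu (complex.Re e); first by rewrite -ltcR -eE.
  exists (u @` [set n | (N <= n)%N], u @` [set n | (N <= n)%N]).
    by split; exists N => // n /= Nn; exists n.
  case=> /= x y [[m Nm <-] [n Nn <-]]; rewrite -ball_normE /ball_/=.
  by rewrite rnormE eE ltcR hN.
move=> /cvgrPdist_lt cu; exists (lim (u @ \oo)) => e e0.
have e0c : 0 < e%:C :> R[i] by rewrite ltcR.
have [N _ hN] := cu _ e0c.
exists N => n Nn; have := hN n Nn.
by rewrite /= distrC rnormE ltcR.
Qed.

Lemma rnorm_limit_le (u : nat -> H) l x r :
  (forall e, 0 < e -> exists N, forall n, (N <= n)%N -> rnorm (u n - l) < e) ->
  (forall n, rnorm (u n - x) <= r) -> rnorm (l - x) <= r.
Proof.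
move=> ul ux; apply/ler_addgt0Pr => e /ul[N /(_ _ (leqnn N)) h].
rewrite (le_trans (rnorm_distD (u N) _ _))// addrC lerD// rnorm_distC ltW//.
Qed.

End InnerProduct.

(** * Bounded operators and representation of functionals *)

Section LinearOperators.
Context {R : realType} {H : hilbertType R}.
Implicit Types (x y z : H) (S T P : H -> H) (a b : R[i]) (r : R).

Lemma linD T x y : linear T -> T (x + y) = T x + T y.
Proof. by move=> lT; rewrite -[x in LHS]scale1r lT scale1r. Qed.

Lemma lin0 T : linear T -> T 0 = 0.
Proof.
by move=> lT; have /eqP := lT 1 0 0; rewrite !scale1r addr0 -subr_eq subrr eq_sym => /eqP.
Qed.

Lemma linZ T a x : linear T -> T (a *: x) = a *: T x.
Proof. by move=> lT; rewrite -[a *: x]addr0 lT lin0// addr0. Qed.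

Lemma linB T x y : linear T -> T (x - y) = T x - T y.
Proof. by move=> lT; rewrite linD// -scaleN1r linZ// scaleN1r. Qed.

Lemma lin_sum (I : Type) (s : seq I) (F : I -> H) T : linear T ->
  T (\sum_(i <- s) F i) = \sum_(i <- s) T (F i).
Proof.
move=> lT; elim: s => [|i s IH]; first by rewrite !big_nil lin0.
by rewrite !big_cons linD// IH.
Qed.

Lemma bounded_op_pos T : bounded_op T ->
  exists2 M : R, 0 < M & forall x, rnorm (T x) <= M * rnorm x.
Proof.
case=> _ [M hM]; exists (`|M| + 1) => [|x]; first by rewrite ltr_wpDl.
by rewrite (le_trans (hM x))// ler_wpM2r ?rnorm_ge0// (le_trans (ler_norm _))// lerDl.
Qed.

Lemma bounded_opD S T : bounded_op S -> bounded_op T -> bounded_op (S + T).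
Proof.
move=> [lS [M hM]] [lT [N hN]]; split=> [a x y|].
  by rewrite !fctE lS lT scalerDr addrACA.
by exists (M + N) => x; rewrite fctE (le_trans (rnormD _ _))// mulrDl lerD.
Qed.

Lemma bounded_opZ a T : bounded_op T -> bounded_op (a *: T).
Proof.
move=> [lT [M hM]]; split=> [b x y|].
  rewrite -![(a *: T) _]/(a *: T _).
  by rewrite lT scalerDr !scalerA mulrC.
exists (complex.Re `|a| * M) => x; rewrite -[(a *: T) x]/(a *: T x).
have aE : `|a| = (complex.Re `|a|)%:C by rewrite RRe_real ?normr_real.
have a0 : 0 <= complex.Re `|a| by rewrite -ler0c -aE normr_ge0.
by rewrite /rnorm normrZ {1}aE cReZ -mulrA ler_wpM2l// hM.
Qed.

Lemma bounded_op0 : bounded_op (0 : H -> H).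
Proof.
split=> [a x y|]; first by rewrite -![(0 : H -> H) _]/(0 : H) scaler0 addr0.
by exists 0 => x; rewrite -[(0 : H -> H) x]/(0 : H) rnorm0 mul0r.
Qed.

Lemma bounded_opB S T : bounded_op S -> bounded_op T -> bounded_op (S - T).
Proof.
by move=> bS bT; rewrite -scaleN1r; apply: bounded_opD => //; apply: bounded_opZ.
Qed.

Lemma bounded_op_sum (I : Type) (s : seq I) (F : I -> H -> H) (Q : pred I) :
  (forall i, bounded_op (F i)) -> bounded_op (\sum_(i <- s | Q i) F i).
Proof.
by move=> bF; elim/big_ind: _ => // [|? ? ? ?]; [exact: bounded_op0|exact: bounded_opD].
Qed.

Lemma rank_one_bounded x y : bounded_op (rank_one x y).
Proof.
split=> [a u v|]; first by rewrite /rank_one ip_linearl scalerDl scalerA.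
(* The factor 2 comes from bounding the real and imaginary parts of [ip z y] separately. *)
exists (2 * rnorm y * rnorm x) => z; rewrite /rank_one.
rewrite (complexE (ip z y)) scalerDl (le_trans (rnormD _ _))// -scalerA.
rewrite rnormMi !rnormZ Im_ip.
have := rip_abs z y; have := rip_abs z ('i%C *: y); rewrite rnormMi /rip.
have := rnorm_ge0 x; set p := rnorm x; set q := rnorm y; set t := rnorm z.
move=> p0 h1 h2; rewrite -mulrDl.
have := ler_wpM2r p0 (lerD h1 h2); lra.
Qed.

(** Polarization: reality of the quadratic form at [x + y] matches the imaginary parts of the two
    sides, and reality at [x + 'i y] matches the real parts. *)
Lemma positive_symmetric P : positive_op P -> forall x y, ip (P x) y = ip x (P y).
Proof.
move=> [[lP _] pP] x y.
have Im0 z : complex.Im (ip (P z) z) = 0 by apply: ger0_Im.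
have := Im0 (x + y); have := Im0 (x + 'i%C *: y).
rewrite !linD// linZ// !ipDl !ipDr !ipZl !ipZr !cImD !cImM !cReM !cRe_conj !cIm_conj !Im0/=.
rewrite [ip x (P y)]ip_conjC.
case: (ip (P x) y) (ip (P y) x) => [a b] [c d]/= h1 h2.
by apply/eqP; rewrite eq_complex/=; apply/andP; split; apply/eqP; move: h1 h2; lra.
Qed.

End LinearOperators.

Section Representation.
Context {R : realType} {H : hilbertType R}.

(* The representing vector minimizes [rip (A x) x - 2 f x]; minimizing sequences
   are Cauchy by the parallelogram identity. *)
Lemma coercive_representation (A : H -> H) (f : H -> R) (eps M K : R) :
  linear A -> (forall x y, rip (A x) y = rip x (A y)) ->
  (forall x, rnorm (A x) <= M * rnorm x) ->
  0 < eps -> (forall x, eps * rnorm x ^+ 2 <= rip (A x) x) ->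
  (forall x y, f (x + y) = f x + f y) -> (forall r x, f (r%:C *: x) = r * f x) ->
  (forall x, f x <= K * rnorm x) ->
  exists g, forall z, rip (A g) z = f z.
Proof.
move=> lA sA bA eps0 cA fD fZ fK.
pose J x := rip (A x) x - 2 * f x.
have JD t x z : J (x + t%:C *: z) = J x + 2 * t * (rip (A x) z - f z) + t ^+ 2 * rip (A z) z.
  by rewrite /J linD// linZ// ripDl !ripDr !ripZl !ripZr fD fZ (sA z x) (ripC z); ring.
have Jlb x : - (K ^+ 2 / eps) <= J x.
  rewrite lerNl -(ler_pM2r eps0) divfK ?gt_eqF// /J.
  have := cA x; have := fK x.
  have := sqr_ge0 (eps * rnorm x - K); have := rnorm_ge0 x; nra.
have infJ : has_inf (range J).
  split; first by exists (J 0), 0.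
  by exists (- (K ^+ 2 / eps)) => _ [x _ <-].
pose m := inf (range J).
have Jm x : m <= J x by apply: ge_inf; [exact: infJ.2 | exists x].
have /choice[u hu] : forall n : nat, exists x, J x < m + n.+1%:R^-1.
  move=> n; have n0 : (0 : R) < n.+1%:R^-1 by rewrite invr_gt0.
  by have [_ [x _ <-] h] := inf_adherent n0 infJ; exists x.
have para x y : eps * rnorm (x - y) ^+ 2 <= 2 * (J x - m) + 2 * (J y - m).
  have := Jm (x + (2^-1)%:C *: (y - x)); rewrite JD.
  have := cA (x - y); rewrite /J.
  have -> : f y = f x + f (y - x) by rewrite -fD addrC subrK.
  have -> : rip (A y) y = rip (A x) x + 2 * rip (A x) (y - x) + rip (A (y - x)) (y - x).
    move: (subrK x y); move: (y - x) => w <-.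
    by rewrite linD// !ripDl !ripDr (sA w x) (ripC w (A x)); ring.
  have -> : rip (A (x - y)) (x - y) = rip (A (y - x)) (y - x).
    rewrite -(opprB y x); move: (y - x) => w.
    by rewrite -[- w]scaleN1r linZ// !scaleN1r ripNl ripNr opprK.
  rewrite fD; lra.
have small (e : R) : 0 < e -> exists N : nat, forall n, (N <= n)%N -> J (u n) - m < e.
  move=> e0; exists (Num.truncn e^-1) => n Nn.
  rewrite ltrBlDl (lt_le_trans (hu n))// lerD2l -[e]invrK lef_pV2 ?posrE ?invr_gt0//.
  by rewrite ltW// (lt_le_trans (truncnS_gt _))// ler_nat.
have [e e0|g hg] := @rnorm_cauchy _ _ u.
  have e2 : 0 < eps * e ^+ 2 / 4 by rewrite divr_gt0// mulr_gt0// exprn_gt0.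
  have [N hN] := small _ e2; exists N => p q Np Nq.
  rewrite -(ltr_pXn2r (_ : (0 < 2)%N)) ?nnegrE ?rnorm_ge0 ?(ltW e0)//.
  rewrite -(ltr_pM2l eps0); have := para (u p) (u q).
  by have := hN _ Np; have := hN _ Nq; lra.
exists g => z.
pose D := rip (A g) z - f z; pose q := rip (A z) z.
have q0 : 0 <= q by rewrite (le_trans _ (cA z))// mulr_ge0 ?sqr_ge0// ltW.
(* [J (u n + t z)] is at least [m] while [J (u n)] tends to [m]; letting [n] grow yields minimality
   of [g] in the direction [z]. *)
have var (t : R) : 0 <= 2 * t * D + t ^+ 2 * q.
  rewrite -oppr_le0; apply/ler_addgt0Pr => e e0; rewrite add0r.
  pose B := 2 * `|t| * M * rnorm z.
  have e2 : 0 < e / 2 by rewrite divr_gt0.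
  have e3 : 0 < e / 2 / (`|B| + 1) by rewrite divr_gt0// ltr_wpDl.
  have [N1 h1] := small _ e2; have [N2 h2] := hg _ e3.
  pose n := maxn N1 N2.
  have := h1 n (leq_maxl _ _); have := h2 n (leq_maxr _ _).
  rewrite ltr_pdivlMr ?ltr_wpDl// => hB hJ.
  have := Jm (u n + t%:C *: z); rewrite JD -/q => hm.
  have : 2 * t * (rip (A (u n)) z - rip (A g) z) <= `|B| * rnorm (u n - g).
    rewrite -ripBl -linB// (@le_trans _ _ (B * rnorm (u n - g)))//; last first.
      by rewrite ler_wpM2r ?rnorm_ge0// ler_norm.
    rewrite (le_trans (ler_norm _))// normrM normrM [ `|2| ]ger0_norm// /B -!mulrA.
    rewrite ler_pM2l// ler_wpM2l// (le_trans (rip_abs _ _))//.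
    by rewrite [rnorm z * _]mulrC mulrA ler_wpM2r ?rnorm_ge0.
  have := rnorm_ge0 (u n - g); rewrite /D; nra.
(* The optimal [t] would be [- D / q]; the added 1 covers [q = 0] and still leaves a negative
   multiple of [D ^+ 2]. *)
have := var (- D / (q + 1)).
have -> : 2 * (- D / (q + 1)) * D + (- D / (q + 1)) ^+ 2 * q =
   - (D ^+ 2 * (q + 2)) / (q + 1) ^+ 2 by field; rewrite gt_eqF// ltr_wpDl.
rewrite pmulr_lge0 ?invr_gt0 ?exprn_gt0 ?ltr_wpDl// oppr_ge0.
rewrite pmulr_lle0 ?ltr_wpDl// => D0.
by apply/eqP; rewrite -subr_eq0 -/D -sqrf_eq0 eq_le D0 sqr_ge0.
Qed.

(** A complex-linear functional is determined by its real part, since [Im (f z) = - Re (f ('i z))];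
    the real part is represented by [coercive_representation] for the identity. *)
Lemma riesz (f : H -> R[i]) (K : R) :
  (forall a x y, f (a *: x + y) = a * f x + f y) ->
  (forall x, complex.Re (f x) <= K * rnorm x) -> exists g, forall z, ip z g = f z.
Proof.
move=> lf fK.
have f0 : f 0 = 0.
  by have /eqP := lf 1 0 0; rewrite scaler0 addr0 mul1r addrC -subr_eq subrr eq_sym => /eqP.
have fD x y : f (x + y) = f x + f y by rewrite -[x in LHS]scale1r lf mul1r.
have fZ a x : f (a *: x) = a * f x by rewrite -[a *: x]addr0 lf f0 addr0.
have [g hg] : exists g, forall z, rip g z = complex.Re (f z).
  apply: (@coercive_representation id _ 1 1 K) => // [x|x|x y|r x].
  - by rewrite mul1r.
  - by rewrite mul1r ripxx.
  - by rewrite fD cReD.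
  - by rewrite fZ cReZ.
exists g => z; apply/eqP; rewrite eq_complex.
rewrite -[complex.Re _]/(rip z g) ripC hg eqxx/=; apply/eqP.
have := hg ('i%C *: z); rewrite ripC /rip ipZl fZ !cReM/=; lra.
Qed.

Lemma adjoint_exists (T : H -> H) : bounded_op T -> exists S, is_adjoint T S.
Proof.
move=> bT; have [lT _] := bT; have [M M0 hM] := bounded_op_pos bT.
have /choice[S hS] : forall y, exists g, forall z, ip z g = ip (T z) y.
  move=> y; apply: (@riesz _ (M * rnorm y)) => [a x z|x].
    by rewrite lT ip_linearl.
  by rewrite (le_trans (rip_le _ _))// mulrAC ler_wpM2r// rnorm_ge0.
exists S; split=> [|x y]; last by rewrite hS.
split=> [a x y|].
  by apply: ip_eqr => z; rewrite hS !ipDr !ipZr !hS.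
exists M => x; have [->|x0] := eqVneq (rnorm (S x)) 0.
  by rewrite mulr_ge0 ?rnorm_ge0// ltW.
have s0 : 0 < rnorm (S x) by rewrite lt_neqAle eq_sym x0 rnorm_ge0.
rewrite -(ler_pM2l s0) -expr2 -ripxx /rip hS (le_trans (rip_le _ _))//.
by rewrite mulrA [_ * M]mulrC ler_wpM2r// rnorm_ge0.
Qed.

End Representation.

(** * Absolute value of a bounded operator *)

Section SquareRoot.
Context {R : realType} {H : hilbertType R}.
Variable B : H -> H.
Hypothesis lin_B : linear B.
Hypothesis B_le1 : forall x, rnorm (B x) <= rnorm x.
Hypothesis B_sym : forall x y, ip (B x) y = ip x (B y).

(** Fixed-point iteration for [Y = (B + Y^2) / 2], an equation equivalent to [(1 - Y)^2 = 1 - B]. *)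
Fixpoint sqrt_iter (n : nat) : H -> H :=
  if n is n'.+1 then
    fun x => (2^-1)%:C *: (B x + sqrt_iter n' (sqrt_iter n' x))
  else fun=> 0.

(** The same recursion with [B] replaced by the scalar 1. It majorizes both the iterates and their
    increments, so convergence of the iterates follows from that of a bounded monotone real
    sequence. *)
Fixpoint sqrt_bound (n : nat) : R :=
  if n is n'.+1 then (1 + sqrt_bound n' ^+ 2) / 2 else 0.

Lemma sqrt_iterS n x : sqrt_iter n.+1 x =
  (2^-1)%:C *: (B x + sqrt_iter n (sqrt_iter n x)).
Proof. by []. Qed.

Lemma sqrt_boundS n : sqrt_bound n.+1 = (1 + sqrt_bound n ^+ 2) / 2.
Proof. by []. Qed.

Lemma sqrt_bound01 n : 0 <= sqrt_bound n <= 1.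
Proof.
elim: n => [|n /andP[h0 h1]] /=; first by rewrite lexx ler01.
by apply/andP; split; nra.
Qed.

Lemma sqrt_bound_ge0 n : 0 <= sqrt_bound n.
Proof. by have /andP[] := sqrt_bound01 n. Qed.

Lemma sqrt_bound_nd n : sqrt_bound n <= sqrt_bound n.+1.
Proof.
have /andP[h0 h1] := sqrt_bound01 n.
by rewrite /=; have := sqr_ge0 (sqrt_bound n - 1); lra.
Qed.

Lemma sqrt_iter_lin n : linear (sqrt_iter n).
Proof.
elim: n => [|n IH] a x y /=; first by rewrite scaler0 addr0.
rewrite lin_B !IH !scalerDr !scalerA [_%:C * a]mulrC.
by rewrite !addrA; congr (_ + _); rewrite -!addrA; congr (_ + _); rewrite addrC.
Qed.

Lemma sqrt_iter_sym n x y : ip (sqrt_iter n x) y = ip x (sqrt_iter n y).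
Proof.
elim: n x y => [|n IH] x y /=; first by rewrite ip0l ip0r.
by rewrite ipZl ipZr conj_real ipDl ipDr B_sym !IH.
Qed.

Lemma sqrt_iter_le n x : rnorm (sqrt_iter n x) <= sqrt_bound n * rnorm x.
Proof.
elim: n x => [|n IH] x /=; first by rewrite rnorm0 mul0r.
rewrite rnormZ ger0_norm// [leRHS]mulrAC [leRHS]mulrC ler_wpM2l//.
rewrite mulrDl mul1r (le_trans (rnormD _ _))// lerD// (le_trans (IH _))//.
by rewrite expr2 -mulrA ler_wpM2l// sqrt_bound_ge0.
Qed.

(** Writing [Y_n] for [sqrt_iter n], the induction rests on [Y_(n+1)^2 - Y_n^2 = Y_(n+1) (Y_(n+1) -
    Y_n) + (Y_(n+1) - Y_n) Y_n]; the scalar majorant satisfies the same identity, so the bounds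
    match term by term. *)
Lemma sqrt_iter_step n x :
  rnorm (sqrt_iter n.+1 x - sqrt_iter n x) <=
  (sqrt_bound n.+1 - sqrt_bound n) * rnorm x.
Proof.
elim: n x => [|n IH] x.
  rewrite /= subr0 addr0 rnormZ expr0n/= addr0 subr0 mul1r ger0_norm//.
  by rewrite ler_wpM2l.
have -> : sqrt_iter n.+2 x - sqrt_iter n.+1 x =
   (2^-1)%:C *: (sqrt_iter n.+1 (sqrt_iter n.+1 x - sqrt_iter n x) +
                 (sqrt_iter n.+1 (sqrt_iter n x) - sqrt_iter n (sqrt_iter n x))).
  rewrite (linB _ _ (sqrt_iter_lin n.+1)) addrA subrK.
  rewrite (sqrt_iterS n.+1 x) [X in _ - X = _]sqrt_iterS -scalerBr.
  congr (_ *: _).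
  by rewrite opprD addrACA subrr add0r.
have -> : sqrt_bound n.+2 - sqrt_bound n.+1 = 2^-1 *
   (sqrt_bound n.+1 * (sqrt_bound n.+1 - sqrt_bound n) +
    (sqrt_bound n.+1 - sqrt_bound n) * sqrt_bound n).
  rewrite (sqrt_boundS n.+1) [X in _ - X = _]sqrt_boundS; by field.
have d0 : 0 <= sqrt_bound n.+1 - sqrt_bound n by rewrite subr_ge0 sqrt_bound_nd.
rewrite rnormZ ger0_norm// -mulrA ler_wpM2l// (le_trans (rnormD _ _))// mulrDl lerD//.
  by rewrite (le_trans (sqrt_iter_le _ _))// -mulrA ler_wpM2l// sqrt_bound_ge0.
by rewrite (le_trans (IH _))// -mulrA ler_wpM2l// sqrt_iter_le.
Qed.

Lemma sqrt_iter_cauchy m n x : (m <= n)%N ->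
  rnorm (sqrt_iter n x - sqrt_iter m x) <= (sqrt_bound n - sqrt_bound m) * rnorm x.
Proof.
move=> /subnK<-; elim: (n - m)%N => [|k IH]; first by rewrite add0n !subrr rnorm0 mul0r.
rewrite addSn (le_trans (rnorm_distD (sqrt_iter (k + m) x) _ _))//.
by have := lerD (sqrt_iter_step (k + m) x) IH; lra.
Qed.

Lemma sqrt_bound_cauchy (e : R) : 0 < e ->
  exists N, forall m n, (N <= m)%N -> (N <= n)%N ->
    `|sqrt_bound m - sqrt_bound n| < e.
Proof.
move=> e0.
have : cvgn sqrt_bound.
  apply: nondecreasing_is_cvgn; first by apply/nondecreasing_seqP; exact: sqrt_bound_nd.
  by exists 1 => _ [n _ <-]; have /andP[] := sqrt_bound01 n.
move=> /cvgrPdist_lt /(_ (e / 2)); rewrite divr_gt0// => /(_ isT)[N _ hN].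
exists N => m n Nm Nn; have := hN _ Nm; have := hN _ Nn; set l := limn _ => /= h1 h2.
have -> : sqrt_bound m - sqrt_bound n = (l - sqrt_bound n) - (l - sqrt_bound m) by ring.
by rewrite (le_lt_trans (ler_normB _ _))//; lra.
Qed.

Lemma sqrt_iter_limit : exists Y : H -> H,
  [/\ linear Y, (forall x, rnorm (Y x) <= rnorm x),
      (forall x y, ip (Y x) y = ip x (Y y)) &
      forall x, Y x + Y x = B x + Y (Y x)].
Proof.
have bnd n m x (e : R) : (m <= n)%N -> `|sqrt_bound n - sqrt_bound m| < e ->
    rnorm (sqrt_iter n x - sqrt_iter m x) <= e * rnorm x.
  move=> mn h; rewrite (le_trans (sqrt_iter_cauchy x mn))// ler_wpM2r ?rnorm_ge0//.
  by rewrite ltW// (le_lt_trans (ler_norm _)).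
have /choice[Y hY] : forall x, exists l, forall e, 0 < e -> exists N, forall n,
    (N <= n)%N -> rnorm (sqrt_iter n x - l) < e.
  move=> x; apply: rnorm_cauchy => e e0.
  have e1 : 0 < e / (rnorm x + 1) by rewrite divr_gt0// ltr_wpDl ?rnorm_ge0.
  have [N hN] := sqrt_bound_cauchy e1; exists N => m n Nm Nn.
  have h : rnorm (sqrt_iter m x - sqrt_iter n x) <= e / (rnorm x + 1) * rnorm x.
    have [mn|nm] := leqP m n; first by rewrite rnorm_distC bnd// hN.
    by apply: bnd (ltnW nm) _; exact: hN.
  rewrite (le_lt_trans h)// mulrAC ltr_pdivrMr ?ltr_wpDl ?rnorm_ge0//.
  by rewrite ltr_pM2l// ltrDl.
(* Uniqueness of limits: identities for [Y] are reduced to convergence statements about the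
   iterates. *)
have lim_eq x y : (forall e, 0 < e -> exists N, forall n, (N <= n)%N ->
    rnorm (sqrt_iter n x - y) < e) -> Y x = y.
  move=> h; apply/eqP; rewrite -subr_eq0 -rnorm_eq0 eq_le rnorm_ge0 andbT.
  apply/ler_addgt0Pr => e e0; rewrite add0r.
  have e2 : 0 < e / 2 by rewrite divr_gt0.
  have [N1 h1] := h _ e2; have [N2 h2] := hY x _ e2; pose n := maxn N1 N2.
  rewrite (le_trans (rnorm_distD (sqrt_iter n x) _ _))// [rnorm (Y x - _)]rnorm_distC.
  by have := h1 n (leq_maxl _ _); have := h2 n (leq_maxr _ _); lra.
have Yle x : rnorm (Y x) <= rnorm x.
  rewrite -[Y x]subr0; apply: (rnorm_limit_le (hY x)) => n; rewrite subr0.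
  rewrite (le_trans (sqrt_iter_le _ _))// ler_piMl ?rnorm_ge0//.
  by have /andP[] := sqrt_bound01 n.
have iter_le n x : rnorm (sqrt_iter n x) <= rnorm x.
  rewrite (le_trans (sqrt_iter_le _ _))// ler_piMl ?rnorm_ge0//.
  by have /andP[] := sqrt_bound01 n.
exists Y; split=> //.
- move=> a x y; apply: lim_eq => e e0.
  pose K := complex.Re `|a|.
  have K0 : 0 <= K by rewrite -ler0c /K RRe_real ?normr_real ?normr_ge0.
  have e1 : 0 < e / (K + 1) by rewrite divr_gt0// ltr_wpDl.
  have [N1 h1] := hY x _ e1; have [N2 h2] := hY y _ e1.
  exists (maxn N1 N2) => n; rewrite geq_max => /andP[/h1 {}h1 /h2 {}h2].
  rewrite sqrt_iter_lin opprD addrACA -scalerBr (le_lt_trans (rnormD _ _))//.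
  have -> : rnorm (a *: (sqrt_iter n x - Y x)) = K * rnorm (sqrt_iter n x - Y x).
    by rewrite [LHS]/rnorm normrZ (_ : `|a| = K%:C) ?cReZ// /K RRe_real ?normr_real.
  have -> : e = K * (e / (K + 1)) + e / (K + 1) by field; rewrite gt_eqF// ltr_wpDl.
  by rewrite ler_ltD// ler_wpM2l// ltW.
- have key x y : rip (Y x) y = rip x (Y y).
    apply/eqP; rewrite -subr_eq0 -normr_eq0 eq_le normr_ge0 andbT.
    apply/ler_addgt0Pr => e e0; rewrite add0r.
    have e1 : 0 < e / (rnorm x + rnorm y + 1).
      by rewrite divr_gt0// ltr_wpDl// addr_ge0 ?rnorm_ge0.
    have [N1 h1] := hY x _ e1; have [N2 h2] := hY y _ e1; pose n := maxn N1 N2.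
    have -> : rip (Y x) y - rip x (Y y) =
       rip x (sqrt_iter n y - Y y) - rip (sqrt_iter n x - Y x) y.
      rewrite ripBl ripBr (_ : rip (sqrt_iter n x) y = rip x (sqrt_iter n y)); first by ring.
      by rewrite /rip sqrt_iter_sym.
    rewrite (le_trans (ler_normB _ _))// (le_trans (lerD (rip_abs _ _) (rip_abs _ _)))//.
    have := h1 n (leq_maxl _ _); have := h2 n (leq_maxr _ _); set q := _ / _ => a1 a2.
    have -> : e = q * (rnorm x + rnorm y + 1).
      by rewrite /q divfK// gt_eqF// ltr_wpDl// addr_ge0 ?rnorm_ge0.
    have := ler_wpM2l (rnorm_ge0 x) (ltW a1); have := ler_wpM2r (rnorm_ge0 y) (ltW a2).
    have : 0 < q by []; lra.
  move=> x y; apply/eqP; rewrite eq_complex -!/(rip _ _) key eqxx/= !Im_ip.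
  rewrite key; apply/eqP; congr (rip x _).
  apply: lim_eq => e /(hY y)[N hN]; exists N => n /hN.
  by rewrite (linZ _ _ (@sqrt_iter_lin n)) -scalerBr rnormMi.
- move=> x; suff h : Y x = (2^-1)%:C *: (B x + Y (Y x)).
    have half : 2^-1 + 2^-1 = 1 :> R by field.
    by rewrite [in LHS]h -scalerDl -rmorphD half rmorph1 scale1r.
  apply: lim_eq => e e0.
  have [N1 h1] := hY x _ e0; have [N2 h2] := hY (Y x) _ e0.
  exists (maxn N1 N2).+1 => -[//|n]; rewrite ltnS geq_max => /andP[/h1 {}h1 /h2 {}h2].
  rewrite /= -scalerBr opprD addrACA subrr add0r rnormZ ger0_norm// ltr_pdivrMl// mulr2n.
  rewrite mulrDl mul1r (le_lt_trans (rnorm_distD (sqrt_iter n (Y x)) _ _))// ltrD//.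
  by rewrite -(linB _ _ (@sqrt_iter_lin n)) (le_lt_trans (iter_le _ _)).
Qed.

End SquareRoot.

Section AbsoluteValue.
Context {R : realType} {H : hilbertType R}.

(* Square root of [c S T = 1 - B] as [1 - Y], where [2 Y = B + Y ^ 2]. *)
Lemma abs_op_exists (T : H -> H) : bounded_op T -> is_abs_op T (abs_op T).
Proof.
move=> bT; have [S adS] := adjoint_exists bT.
suff exP : exists P, is_abs_op T P by exact: (xgetPex _ exP).
have [bS hS] := adS; have [lT _] := bT; have [lS _] := bS.
have [K K0 hK] := bounded_op_pos bS.
(* [K] bounds the adjoint [S]. This [c] gives [c^2 |S T x|^2 <= c |T x|^2], which is less than the
   cross term [2 c |T x|^2] can absorb, so [B] is a contraction. *)
pose c : R := (K ^+ 2 + 1)^-1.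
have c0 : 0 < c by rewrite invr_gt0 ltr_wpDl// sqr_ge0.
pose B x := x - c%:C *: S (T x).
have lB : linear B.
  move=> a x y; rewrite /B lT lS !scalerDr !scalerN !scalerA [_%:C * a]mulrC.
  by rewrite opprD addrACA.
have symST x y : ip (S (T x)) y = ip x (S (T y)).
  by rewrite ip_conjC -hS -ip_conjC hS.
have B_sym x y : ip (B x) y = ip x (B y).
  rewrite /B ipDl ipDr -!scaleNr !ipZl !ipZr symST rmorphN/=.
  by rewrite conj_real.
have B_le x : rnorm (B x) <= rnorm x.
  rewrite -(ler_pXn2r (_ : (0 < 2)%N)) ?nnegrE ?rnorm_ge0//.
  rewrite rnormB2 ripZr rnormZ exprMn (ger0_norm (ltW c0)).
  rewrite (_ : rip x (S (T x)) = rnorm (T x) ^+ 2); last by rewrite /rip -hS -/(rip _ _) ripxx.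
  have : rnorm (S (T x)) ^+ 2 <= K ^+ 2 * rnorm (T x) ^+ 2.
    by rewrite -exprMn ler_pXn2r ?nnegrE ?mulr_ge0 ?rnorm_ge0// ltW.
  have : c * (K ^+ 2 + 1) = 1 by rewrite mulVf// gt_eqF// ltr_wpDl// sqr_ge0.
  have := sqr_ge0 (rnorm (T x)).
  move: (rnorm (T x) ^+ 2) (rnorm (S (T x)) ^+ 2) (rnorm x ^+ 2) => t s u t0 cK st.
  have : c ^+ 2 * s <= c ^+ 2 * (K ^+ 2 * t) by rewrite ler_wpM2l// sqr_ge0.
  have -> : c ^+ 2 * (K ^+ 2 * t) = c * (c * (K ^+ 2 + 1)) * t - c ^+ 2 * t by ring.
  rewrite cK mulr1.
  have := mulr_ge0 (ltW c0) t0; have := mulr_ge0 (sqr_ge0 c) t0; lra.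
have [Y [lY Yle Ysym YE]] := sqrt_iter_limit lB B_le B_sym.
(* [k^2 c = 1] undoes the scaling in [(1 - Y)^2 = 1 - B = c S T]. *)
pose k := (Num.sqrt c)^-1.
have k0 : 0 <= k by rewrite invr_ge0 sqrtr_ge0.
have kk : k * k * c = 1.
  rewrite /k -invfM -expr2 sqr_sqrtr ?ltW// mulVf// gt_eqF//.
pose P x := k%:C *: (x - Y x).
exists P; split.
  split.
    split=> [a x y|].
      by rewrite /P lY opprD addrACA -scalerBr scalerDr !scalerA [_%:C * a]mulrC.
    exists (k * 2) => x; rewrite /P rnormZ ger0_norm// -mulrA ler_wpM2l//.
    by rewrite (le_trans (rnormB _ _))//; have := Yle x; lra.
  move=> x; rewrite lecE/= /P ipZl cImZ cReZ; apply/andP; split.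
    rewrite ipDl -scaleN1r ipZl cImD cImM/= ipxx/=.
    have := ip_conjC (Y x) x; rewrite -Ysym.
    case: (ip (Y x) x) => p q /= [qE]; have -> : q = 0 by lra.
    by apply/eqP; ring.
  rewrite mulr_ge0// -/(rip _ _) ripBl ripxx.
  by have := rip_le (Y x) x; have := Yle x; have := rnorm_ge0 x; nra.
exists S => //; apply/funext => x /=.
rewrite /P (linZ _ _ lY) (linB _ _ lY) -scalerBr scalerA.
have -> : x - Y x - (Y x - Y (Y x)) = c%:C *: S (T x).
  rewrite opprB [Y (Y x) - _]addrC addrA -[x - Y x - Y x]addrA -opprD YE opprD addrA.
  by rewrite subrK /B opprB addrC subrK.
by rewrite scalerA -!rmorphM/= kk scale1r.
Qed.

End AbsoluteValue.

(** * Duality for the trace norm *)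

Section TraceNorm.
Context {R : realType} {H : hilbertType R}.
Implicit Types (s : seq H) (f : H -> H) (T P : H -> H) (M : R).

(** Orthonormality concerns the set of entries and does not see repetitions; [uniq] excludes
    them. *)
Definition ortho_seq s : Prop := uniq s /\ Defs.orthonormal [set e | e \in s].

(** On an orthonormal [s], this says that [e |-> f e] extends to a linear contraction on the span,
    without building an operator on all of [H]. *)
Definition contractive_on s f : Prop := forall c : H -> R[i],
  rnorm (\sum_(e <- s) c e *: f e) <= rnorm (\sum_(e <- s) c e *: e).

(* The functionals [T |-> Re tr (V^* T p)] with [p] the projection on the span of
   [s] and [V] the contraction mapping [e] to [f e]. *)
Definition trace_functional : set ((H -> H) -> R) :=
  [set l | exists s f, [/\ ortho_seq s, contractive_on s f &
     forall T, l T = \sum_(e <- s) rip (T e) (f e)]].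

(** Stands for a trace norm at most [M], in a form that passes to sums and scalar multiples at
    once. *)
Definition nuclear_le T M : Prop := forall l, trace_functional l -> l T <= M.

Lemma ip_ortho_sum s (c : H -> R[i]) e : ortho_seq s -> e \in s ->
  ip (\sum_(u <- s) c u *: u) e = c e.
Proof.
move=> [us [s1 s0]] es.
have sumE : forall t : seq H, ip (\sum_(u <- t) c u *: u) e = \sum_(u <- t) c u * ip u e.
  elim=> [|u t IH]; first by rewrite !big_nil ip0l.
  by rewrite !big_cons ipDl ipZl IH.
rewrite sumE (bigD1_seq e)//= s1// mulr1 big_seq_cond big1 ?addr0// => u /andP[ut ue].
by rewrite s0// mulr0.
Qed.

(** The projection [p] satisfies [<p, p> = <x, p>]; Cauchy-Schwarz and cancellation of [|p|]
    conclude. *)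
Lemma bessel s x : ortho_seq s -> rnorm (\sum_(e <- s) ip x e *: e) <= rnorm x.
Proof.
move=> os; set p := \sum_(e <- s) _.
have pp : rip p p = rip x p.
  rewrite {2 3}/p !rip_sumr !big_seq; apply: eq_bigr => e es.
  by rewrite /rip !ipZr /p ip_ortho_sum.
have := rip_le x p; rewrite -pp ripxx expr2.
have [->|p0] := eqVneq (rnorm p) 0; first by rewrite rnorm_ge0.
by rewrite ler_pM2r// lt_neqAle eq_sym p0 rnorm_ge0.
Qed.

Lemma trace_functional_add l S T : trace_functional l -> l (S + T) = l S + l T.
Proof.
case=> s [f [_ _ lE]]; rewrite !lE -big_split/=.
by apply: eq_bigr => e _; rewrite ripDl.
Qed.

Lemma trace_functional_scale l r T : trace_functional l ->
  l (r%:C *: T) = r * l T.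
Proof.
case=> s [f [_ _ lE]]; rewrite !lE mulr_sumr.
by apply: eq_bigr => e _; rewrite -ripZl.
Qed.

(** Closure under sign turns the one-sided bounds of [nuclear_le] into two-sided ones. *)
Lemma trace_functional_opp l : trace_functional l ->
  trace_functional (fun T => - l T).
Proof.
case=> s [f [os fs lE]]; exists s, (fun e => - f e); split=> // [c|T].
  under eq_bigr do rewrite scalerN.
  by rewrite sumrN rnormN.
by rewrite lE -sumrN; apply: eq_bigr => e _; rewrite ripNr.
Qed.

(** The functional takes the value [<x, sum_e <y, e> f e>]; contractivity and Bessel bound the
    second vector by [|y|]. *)
Lemma nuclear_le_rank_one x y : nuclear_le (rank_one x y) (rnorm x * rnorm y).
Proof.
move=> _ [s [f [os fs ->]]].
have -> : \sum_(e <- s) rip (rank_one x y e) (f e) = rip x (\sum_(e <- s) ip y e *: f e).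
  rewrite rip_sumr; apply: eq_bigr => e _.
  by rewrite /rip /rank_one ipZl ipZr -ip_conjC.
rewrite (le_trans (rip_le _ _))// ler_wpM2l ?rnorm_ge0//.
exact: le_trans (fs _) (bessel _ os).
Qed.

Lemma nuclear_le_ge0 T M : nuclear_le T M -> 0 <= M.
Proof.
move=> h; apply: (h (fun=> 0)); exists [::], id; by split=> // *; rewrite !big_nil.
Qed.

Lemma nuclear_leD S T M N : nuclear_le S M -> nuclear_le T N ->
  nuclear_le (S + T) (M + N).
Proof. by move=> hS hT l hl; rewrite trace_functional_add// lerD ?hS ?hT. Qed.

Lemma nuclear_leZ r T M : nuclear_le T M -> nuclear_le (r%:C *: T) (`|r| * M).
Proof.
move=> hT l hl; rewrite trace_functional_scale//.
have [r0|r0] := leP 0 r; first by rewrite ger0_norm// ler_wpM2l// hT.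
rewrite ltr0_norm// mulNr -mulrN ler_nM2l// lerNl.
exact: hT (trace_functional_opp hl).
Qed.

Lemma nuclear_le0 : nuclear_le 0 0.
Proof. by move=> _ [s [f [_ _ ->]]]; rewrite big1// => e _; rewrite rip0l. Qed.

Lemma nuclear_le_sum (I : Type) (r : seq I) (Q : pred I) (F : I -> H -> H) (m : I -> R) :
  (forall i, nuclear_le (F i) (m i)) ->
  nuclear_le (\sum_(i <- r | Q i) F i) (\sum_(i <- r | Q i) m i).
Proof.
move=> h; elim/big_rec2: _ => [|i ? ? _]; first exact: nuclear_le0.
exact: nuclear_leD.
Qed.

(* With [(P + eps) g = e], the vectors [T g] are the images of the [e]'s under
   the contraction [T (P + eps)^-1], which approximates the partial isometry of
   the polar decomposition. *)
Lemma nuclear_le_trace_seq T P M s : bounded_op T -> is_abs_op T P ->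
  nuclear_le T M -> ortho_seq s -> \sum_(e <- s) rip (P e) e <= M.
Proof.
move=> [lT _] [pP [S [bS hS] PPE]] TM os.
have Psym := positive_symmetric pP.
have rPsym x y : rip (P x) y = rip x (P y) by rewrite /rip Psym.
have [bP P0] := pP; have [lP _] := bP; have [K K0 hK] := bounded_op_pos bP.
have rP0 x : 0 <= rip (P x) x by have := P0 x; rewrite lecE => /andP[].
have TT x y : rip (T x) (T y) = rip (P x) (P y).
  by rewrite /rip hS -[S (T y)]/((S \o T) y) -PPE/= Psym.
have TP x : rnorm (T x) = rnorm (P x).
  by apply/eqP; rewrite -(eqrXn2 (_ : 0 < 2)%N) ?rnorm_ge0// -!ripxx TT.
apply/ler_addgt0Pr => d d0.
(* Each vector of [s] will cost at most [eps]; the successor keeps the denominator positive when [s]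
   is empty. *)
pose eps := d / (size s).+1%:R.
have e0 : 0 < eps by rewrite divr_gt0.
pose A x := P x + eps%:C *: x.
have lA : linear A.
  by move=> a x y; rewrite /A lP !scalerDr !scalerA [_%:C * a]mulrC addrACA.
have /choice[g hg] : forall e, exists g, A g = e.
  move=> e.
  suff [g hg] : exists g, forall z, rip (A g) z = rip z e.
    by exists g; apply: rip_eq => z; rewrite ripC hg.
  apply: (@coercive_representation _ _ A (rip^~ e) eps (K + eps) (rnorm e)) => //.
  - by move=> x y; rewrite /A ripDl ripDr ripZl ripZr rPsym.
  - move=> x; rewrite (le_trans (rnormD _ _))// rnormZ (ger0_norm (ltW e0)) mulrDl.
    by rewrite lerD2r hK.
  - by move=> x; rewrite /A ripDl ripZl ripxx lerDr.
  - by move=> x y; rewrite ripDl.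
  - by move=> r x; rewrite ripZl.
  - by move=> x; rewrite mulrC rip_le.
(* As [P] is positive, the cross term in [|P x + eps x|^2] is nonnegative. *)
have PA x : rnorm (P x) <= rnorm (A x).
  rewrite -(ler_pXn2r (_ : 0 < 2)%N) ?nnegrE ?rnorm_ge0// /A rnormD2 ripZr.
  rewrite -addrA lerDl addr_ge0 ?sqr_ge0// !mulr_ge0// ltW//.
pose f e := T (g e).
have fs : contractive_on s f.
  move=> c; pose v := \sum_(e <- s) c e *: g e.
  have -> : \sum_(e <- s) c e *: f e = T v.
    by rewrite /v lin_sum//; apply: eq_bigr => e _; rewrite (linZ _ _ lT).
  have -> : \sum_(e <- s) c e *: e = A v.
    by rewrite /v lin_sum//; apply: eq_bigr => e _; rewrite (linZ _ _ lA) hg.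
  by rewrite TP PA.
have /TM : trace_functional (fun T => \sum_(e <- s) rip (T e) (f e)) by exists s, f.
rewrite -(lerD2r d); apply: le_trans.
have -> : d = \sum_(e <- s) eps + eps.
  by rewrite big_const_seq count_predT iter_addr_0 -mulrSr -[eps *+ _]mulr_natr divfK.
rewrite addrA -big_split/= -[leLHS]addr0 lerD ?(ltW e0)//.
rewrite big_seq [leRHS]big_seq ler_sum// => e es.
have e1 : rnorm e = 1.
  apply/eqP; rewrite -(eqrXn2 (_ : 0 < 2)%N) ?rnorm_ge0// -ripxx /rip.
  by rewrite os.2.1// expr1n.
(* Here [A (g e) = e]. The first term is the value of the functional, and the second is at most
   [eps], since [<P e, g e> = <e, P (g e)> <= |A (g e)| = 1]. *)
have -> : rip (P e) e = rip (P e) (P (g e)) + eps * rip (P e) (g e).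
  by rewrite -{2}(hg e) /A ripDr ripZr.
rewrite /f TT lerD2l -[leRHS]mulr1 ler_pM2l// rPsym (le_trans (rip_le _ _))//.
by rewrite e1 mul1r (le_trans (PA _))// hg e1.
Qed.

(** [trace] is a supremum over finite subsets of the chosen basis, and each of these enumerates an
    [ortho_seq]. *)
Lemma nuclear_le_trace T M : bounded_op T -> nuclear_le T M ->
  (trace (abs_op T) <= M%:E)%E.
Proof.
move=> bT TM; have aT := abs_op_exists bT.
have [oE _] := xgetPex set0 (@ex_hilbert_basis R H).
apply: ge_ereal_sup => _ [A [fA AE] <-].
rewrite fsbig_finite//= sumEFin lee_fin.
apply: (nuclear_le_trace_seq bT aT TM); split; first exact: fset_uniq.
have sub e : e \in fset_set A -> xget set0 (@hilbert_basis R H) e.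
  by rewrite in_fset_set// => /set_mem /AE.
split=> [e /= /sub|e e' /= /sub he /sub]; first exact: oE.1.
exact: oE.2.
Qed.

Lemma nuclear_le_trace_class T M : bounded_op T -> nuclear_le T M -> trace_class T.
Proof.
move=> bT TM; split=> //; first exact: abs_op_exists.
by rewrite (le_lt_trans (nuclear_le_trace bT TM))// ltry.
Qed.

Lemma nuclear_le_trace_norm T M : bounded_op T -> nuclear_le T M ->
  (0 <= trace_norm T <= M%:E)%E.
Proof.
move=> bT TM; rewrite /trace_norm; case: asboolP => [[_ [[_ aP] _] _]|]; last first.
  by move=> /(_ (nuclear_le_trace_class bT TM)).
rewrite nuclear_le_trace// andbT; apply: esum_ge0 => e _.
by rewrite lee_fin; have := aP e; rewrite lecE => /andP[].
Qed.

Lemma cvg_S1_nuclear (T_ : nat -> H -> H) T :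
  (forall n, bounded_op (T_ n)) -> bounded_op T ->
  (forall n, exists M, nuclear_le (T_ n) M) ->
  (forall e, 0 < e -> exists N, forall n, (N <= n)%N -> nuclear_le (T_ n - T) e) ->
  cvg_S1 T_ T.
Proof.
move=> bT_ bT hM hT; split=> [n||].
- by have [M] := hM n; exact: nuclear_le_trace_class.
- have [N /(_ N (leqnn _)) h1] := hT 1 ltr01; have [M h2] := hM N.
  apply: (@nuclear_le_trace_class _ (M + 1)) => //.
  have -> : T = T_ N + (- 1)%:C *: (T_ N - T).
    by rewrite rmorphN rmorph1 scaleN1r opprB addrC subrK.
  apply: nuclear_leD => //; have := nuclear_leZ (- 1) h1.
  by rewrite normrN1 mul1r.
apply/fine_cvgP; split.
  have [N hN] := hT 1 ltr01; exists N => // n /= /hN h.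
  have /andP[h0 h1] := nuclear_le_trace_norm (bounded_opB (bT_ n) bT) h.
  by rewrite ge0_fin_numE// (le_lt_trans h1)// ltry.
apply/cvgrPdist_le => e e0; have [N hN] := hT e e0; exists N => // n /= /hN h.
have /andP[h0 h1] := nuclear_le_trace_norm (bounded_opB (bT_ n) bT) h.
rewrite sub0r normrN ger0_norm ?fine_ge0//.
by rewrite -lee_fin fineK// ge0_fin_numE// (le_lt_trans h1)// ltry.
Qed.

End TraceNorm.

(** * Birkhoff's ergodic theorem *)

Section RealIntegrable.
Context {R : realType} {d : measure_display} {E : measurableType d}.
Variable mu : probability E R.
Implicit Types (f g : E -> R) (r : R).

Definition L1 f : Prop := mu.-integrable setT (EFin \o f).

Lemma L1_measurable f : L1 f -> measurable_fun setT f.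
Proof. by move=> /integrableP[/measurable_EFinP]. Qed.

Lemma L1_cst r : L1 (fun=> r).
Proof. exact: (finite_measure_integrable_cst mu r measurableT). Qed.

Lemma L1D f g : L1 f -> L1 g -> L1 (fun x => f x + g x).
Proof. by move=> hf hg; apply: eq_integrable (integrableD measurableT hf hg). Qed.

Lemma L1Z r f : L1 f -> L1 (fun x => r * f x).
Proof. by move=> hf; apply: eq_integrable (integrableZl measurableT r hf). Qed.

Lemma L1B f g : L1 f -> L1 g -> L1 (fun x => f x - g x).
Proof. by move=> hf hg; apply: eq_integrable (integrableB measurableT hf hg). Qed.

Lemma L1_sum (I : Type) (s : seq I) (F : I -> E -> R) :
  (forall i, L1 (F i)) -> L1 (fun x => \sum_(i <- s) F i x).
Proof.
move=> h; elim: s => [|i s IH].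
  by under [X in L1 X]eq_fun do rewrite big_nil; exact: L1_cst.
by under [X in L1 X]eq_fun do rewrite big_cons; exact: L1D.
Qed.

Lemma L1_le f g : measurable_fun setT f -> (forall x, `|f x| <= g x) -> L1 g -> L1 f.
Proof.
move=> mf fg; apply: le_integrable => //; first exact/measurable_EFinP.
by move=> x _ /=; rewrite lee_fin (le_trans (fg x))// ler_norm.
Qed.

Lemma mean_cst r : \int[mu]_x r = r.
Proof.
rewrite /Rintegral integral_cst//.
by rewrite [X in fine (_ * X)](_ : _ = 1%E) ?mule1//; exact: probability_setT.
Qed.

Lemma meanD f g : L1 f -> L1 g ->
  \int[mu]_x (f x + g x) = \int[mu]_x f x + \int[mu]_x g x.
Proof. exact: RintegralD. Qed.

Lemma meanB f g : L1 f -> L1 g ->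
  \int[mu]_x (f x - g x) = \int[mu]_x f x - \int[mu]_x g x.
Proof. exact: RintegralB. Qed.

Lemma meanZ r f : L1 f -> \int[mu]_x (r * f x) = r * \int[mu]_x f x.
Proof. exact: RintegralZl. Qed.

Lemma mean_le f g : L1 f -> L1 g -> (forall x, f x <= g x) ->
  \int[mu]_x f x <= \int[mu]_x g x.
Proof. by move=> hf hg fg; apply: le_Rintegral. Qed.

Lemma mean_ge0 f : (forall x, 0 <= f x) -> 0 <= \int[mu]_x f x.
Proof. by move=> f0; apply: fine_ge0; apply: integral_ge0 => x _; rewrite lee_fin. Qed.

Lemma mean_sum (I : Type) (s : seq I) (F : I -> E -> R) : (forall i, L1 (F i)) ->
  \int[mu]_x (\sum_(i <- s) F i x) = \sum_(i <- s) \int[mu]_x F i x.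
Proof.
move=> h; elim: s => [|i s IH].
  by under eq_Rintegral do rewrite big_nil; rewrite big_nil mean_cst.
under eq_Rintegral do rewrite big_cons.
by rewrite big_cons meanD ?IH//; exact: L1_sum.
Qed.

(** Monotonicity in [e] reduces an uncountable union of null sets to the countable one over
    [e = 1 / (n + 1)]. *)
Lemma ae_forall_pos (Q : R -> E -> Prop) :
  (forall e e' x, e <= e' -> Q e x -> Q e' x) ->
  (forall e, 0 < e -> {ae mu, forall x, Q e x}) ->
  {ae mu, forall x, forall e, 0 < e -> Q e x}.
Proof.
move=> Qle Qae.
have : {ae mu, forall x, forall n : nat, Q n.+1%:R^-1 x}.
  by apply: ae_foralln => n; apply: Qae; rewrite invr_gt0.
apply: filterS => x h e e0; apply: Qle (h (Num.truncn e^-1)).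
rewrite -[leRHS]invrK lef_pV2 ?posrE ?invr_gt0//.
by rewrite ltW// truncnS_gt.
Qed.

Section Pushforward.
Context {d' : measure_display} {E' : measurableType d'}.
Variables (nu : probability E' R) (phi : E -> E').
Hypothesis mphi : measurable_fun setT phi.
Hypothesis nuE : forall A, measurable A -> nu A = mu (phi @^-1` A).

Let Phi : {mfun E >-> E'} := mfun_Sub (mem_set mphi).

Lemma ge0_integral_image (f : E' -> \bar R) : measurable_fun setT f ->
  (forall x, (0 <= f x)%E) -> (\int[nu]_y f y = \int[mu]_x f (phi x))%E.
Proof.
move=> mf f0; rewrite (@eq_measure_integral _ _ _ setT (distribution mu Phi)).
  by rewrite ge0_integral_distribution.
by move=> A mA _; exact: nuE.
Qed.

Lemma mean_image (f : E' -> R) : measurable_fun setT f ->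
  L1 (fun x => f (phi x)) -> \int[nu]_y f y = \int[mu]_x f (phi x).
Proof.
move=> mf L1f; congr fine.
rewrite (@eq_measure_integral _ _ _ setT (distribution mu Phi)).
  by rewrite integral_distribution//; exact/measurable_EFinP.
by move=> A mA _; exact: nuE.
Qed.

Lemma ae_image (Q : E' -> Prop) : {ae nu, forall y, Q y} -> {ae mu, forall x, Q (phi x)}.
Proof.
case=> A [mA nA QA]; exists (phi @^-1` A); split.
- by rewrite -[_ @^-1` _]setTI; exact: mphi.
- by apply: etrans nA; apply/esym/nuE.
- by move=> x /QA.
Qed.

End Pushforward.

End RealIntegrable.

Lemma L1_image {R : realType} {d d' : measure_display} {E : measurableType d}
    {E' : measurableType d'} (mu : probability E R) (nu : probability E' R)
    (phi : E -> E') :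
  measurable_fun setT phi -> (forall A, measurable A -> nu A = mu (phi @^-1` A)) ->
  forall f : E' -> R, measurable_fun setT f ->
  (L1 nu f <-> L1 mu (fun x => f (phi x))).
Proof.
move=> mphi nuE f mf.
have mnf : measurable_fun setT (fun y => `|(f y)%:E|%E).
  by apply: measurableT_comp => //; exact/measurable_EFinP.
split=> /integrableP[_ h]; apply/integrableP; split.
- by apply/measurable_EFinP; exact: measurableT_comp.
- by move: h; rewrite (ge0_integral_image mphi nuE mnf).
- exact/measurable_EFinP.
- by rewrite (ge0_integral_image mphi nuE mnf).
Qed.

(** * The maximal ergodic inequality and the scalar ergodic theorem *)

Section Birkhoff.
Context {R : realType} {d : measure_display} {E : measurableType d}.
Variables (mu : probability E R) (S : E -> E).
Hypothesis erg : ergodic mu S.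

Let mS : measurable_fun setT S. Proof. exact: erg.1.1. Qed.
Let muS A : measurable A -> mu A = mu (S @^-1` A).
Proof. by move=> mA; rewrite erg.1.2. Qed.

Lemma L1_shift f : L1 mu f -> L1 mu (fun x => f (S x)).
Proof. by move=> hf; apply: (L1_image mS muS (L1_measurable hf)).1. Qed.

Lemma mean_shift f : L1 mu f -> \int[mu]_x f (S x) = \int[mu]_x f x.
Proof.
by move=> hf; rewrite -(mean_image mS muS (L1_measurable hf))//; exact: L1_shift.
Qed.

Lemma L1_iter f k : L1 mu f -> L1 mu (fun x => f (iter k S x)).
Proof.
elim: k f => [//|k IH] f hf; have := L1_shift (IH _ hf).
by congr (L1 mu _); apply/funext => x; rewrite iterSr.
Qed.

Lemma mean_iter f k : L1 mu f -> \int[mu]_x f (iter k S x) = \int[mu]_x f x.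
Proof.
elim: k f => [//|k IH] f hf; rewrite -[RHS]IH// -[RHS]mean_shift; last exact: L1_iter.
by apply: eq_Rintegral => x _; rewrite iterSr.
Qed.

(* [max_sum f n] is the maximum of 0 and the Birkhoff sums of length 1 to n. *)
Fixpoint max_sum (f : E -> R) (n : nat) (x : E) : R :=
  if n is n'.+1 then Num.max 0 (f x + max_sum f n' (S x)) else 0.

Lemma max_sum_ge0 f n x : 0 <= max_sum f n x.
Proof. by case: n => //= n; rewrite le_max lexx. Qed.

Lemma max_sum_nd f n x : max_sum f n x <= max_sum f n.+1 x.
Proof.
elim: n x => [|n IH] x; first exact: max_sum_ge0.
rewrite /= ge_max !le_max lexx/=; apply/orP; right.
by rewrite lerD2l; exact: IH.
Qed.

Lemma max_sum_homo f x m n : (m <= n)%N -> max_sum f m x <= max_sum f n x.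
Proof.
by move=> /subnK<-; elim: (n - m)%N => // k IH; rewrite addSn (le_trans IH)// max_sum_nd.
Qed.

Lemma sum_le_max_sum f n x : \sum_(0 <= k < n) f (iter k S x) <= max_sum f n x.
Proof.
elim: n x => [|n IH] x; first by rewrite big_nil.
rewrite big_nat_recl//= le_max; apply/orP; right; rewrite lerD2l.
by under eq_bigr do rewrite -iterS iterSr; exact: IH.
Qed.

Lemma L1_max_sum f n : L1 mu f -> L1 mu (max_sum f n).
Proof.
move=> hf; elim: n => [|n IH] /=; first exact: L1_cst.
have h := L1D hf (L1_shift IH).
apply: (@L1_le _ _ _ _ _ (fun x => `|f x + max_sum f n (S x)|)).
- by apply: measurable_maxr => //; exact: L1_measurable h.
- move=> x; rewrite ger0_norm ?le_max ?lexx//.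
  by rewrite ge_max normr_ge0 ler_norm.
- by apply: eq_integrable (integrable_abse h).
Qed.

(** Garsia's argument: the integrand dominates [max_sum f n x - max_sum f n (S x)], whose mean is 0
    by invariance. Where [max_sum] is positive this is its recursion; elsewhere the difference is at
    most 0. *)
Lemma maximal_ergodic f n : L1 mu f ->
  0 <= \int[mu]_x (if 0 < max_sum f n x then f x else 0).
Proof.
move=> hf; have hM := L1_max_sum n hf.
have I0 : \int[mu]_x (max_sum f n x - max_sum f n (S x)) = 0.
  by rewrite meanB ?mean_shift ?subrr//; exact: L1_shift.
rewrite -[leLHS]I0; apply: mean_le; first by apply: L1B => //; exact: L1_shift.
- apply: (@L1_le _ _ _ _ _ (fun x => `|f x|)); last first.
  + by apply: eq_integrable (integrable_abse hf).
  + by move=> x /=; case: ifP => _; rewrite ?normr0.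
  + apply: measurable_fun_ifT => //; last exact: L1_measurable hf.
    by apply: measurable_fun_ltr => //; exact: (L1_measurable hM).
- move=> x; case: ltP => [|M0]; last by rewrite lerBlDr add0r (le_trans M0)// max_sum_ge0.
  case: n {hM I0} => [|n]; first by rewrite ltxx.
  move=> h; have -> : max_sum f n.+1 x = f x + max_sum f n (S x).
    by move: h; rewrite /= lt_max ltxx/= => h; rewrite max_r// ltW.
  by rewrite lerBlDr lerD2l max_sum_nd.
Qed.

(** The set where [max_sum] is unbounded is invariant, hence of measure 0 or 1. In the second case
    the integrands of [maximal_ergodic] converge to [f] almost everywhere, and dominated convergence
    contradicts the negative mean. *)
Lemma max_sum_bounded f : L1 mu f -> \int[mu]_x f x < 0 ->
  {ae mu, forall x, exists K, forall n, max_sum f n x <= K}.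
Proof.
move=> hf If.
have mM n : measurable_fun setT (max_sum f n) by exact: L1_measurable (L1_max_sum n hf).
pose A := [set x | forall K, exists n, K < max_sum f n x].
have AE : A = \bigcap_(k : nat) \bigcup_(n : nat) [set x | k%:R < max_sum f n x].
  apply/seteqP; split=> [x Ax k _|x Ax K].
    by have [n hn] := Ax k%:R; exists n.
  have [n _ hn] := Ax (Num.truncn K).+1 I; exists n.
  by rewrite (lt_trans _ hn)// truncnS_gt.
have mA : measurable A.
  rewrite AE; apply: bigcap_measurable => // k _; apply: bigcup_measurable => n _.
  rewrite -[X in measurable X]setTI; exact: measurable_fun_ltr.
have SA : S @^-1` A = A.
  apply/seteqP; split=> x Ax K /=.
    have [n hn] := Ax (K - f x); exists n.+1.
    by rewrite /= lt_max; apply/orP; right; rewrite -ltrBlDl.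
  (* A threshold of at least 0 forces the maximum in [max_sum] to be its second argument. *)
  have [[|n]] := Ax (Num.max 0 (f x + K)); first by rewrite /= gt_max ltxx.
  rewrite /= gt_max => /andP[]; rewrite !lt_max ltxx/= => h0 /orP[h1|].
    by exists n; lra.
  by rewrite ltrD2l => h1; exists n.
have [A0|A1] := erg.2 A mA SA.
  exists A; split=> // x /= h K.
  by apply: contrapT => /forallNP hn; apply: h; exists K => n; rewrite leNgt; exact/negP.
suff : 0 <= \int[mu]_x f x by rewrite leNgt If.
pose g n x := if 0 < max_sum f n x then f x else 0.
have mg n : measurable_fun setT (g n).
  apply: measurable_fun_ifT => //; last exact: L1_measurable hf.
  exact: measurable_fun_ltr.
have [|||||_ _ cvg_int] := @dominated_convergence _ _ _ mu setT measurableT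
  (fun n x => (g n x)%:E) (EFin \o f) (fun x => `|f x|%:E).
- by move=> n; exact/measurable_EFinP.
- exact/measurable_EFinP/(L1_measurable hf).
- have A1' : {ae mu, forall x, A x}.
    exists (~` A); split=> //; first exact: measurableC.
    by rewrite probability_setC// A1 subee.
  apply: filterS A1' => x Ax _; apply: cvg_near_cst.
  have [N hN] := Ax 0; exists N => // n /= Nn.
  by rewrite /g (lt_le_trans hN)// max_sum_homo.
- by apply: eq_integrable (integrable_abse hf).
- by apply: aeW => x n _; rewrite lee_fin /g; case: ifP => _; rewrite ?normr0 ?normr_ge0 ?lexx.
rewrite -lee_fin fineK; last exact: integrable_fin_num.
have cint := cvgP _ cvg_int; rewrite -(cvg_lim (@ereal_hausdorff R) cvg_int).
apply: lime_ge => //.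
apply: nearW => n /=; have := maximal_ergodic n hf.
rewrite -lee_fin fineK// integrable_fin_num//.
have hgn : L1 mu (g n).
  apply: (@L1_le _ _ _ _ _ (fun x => `|f x|)); first exact: mg.
    by move=> x; rewrite /g; case: ifP => _; rewrite ?normr0.
  by apply: eq_integrable (integrable_abse hf).
exact: hgn.
Qed.

(** Apply [max_sum_bounded] to [f - c], of mean [- e / 2]: the sums of [f] are at most [K + n c],
    and [K <= n e / 2] once [n >= 2 |K| / e]. *)
Lemma birkhoff_upper f e : L1 mu f -> 0 < e ->
  {ae mu, forall x, exists N, forall n, (N <= n)%N ->
     n%:R^-1 * (\sum_(0 <= k < n) f (iter k S x)) <= \int[mu]_x f x + e}.
Proof.
move=> hf e0; pose c := \int[mu]_x f x + e / 2.
have hg : L1 mu (fun x => f x - c) by apply: L1B => //; exact: L1_cst.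
have := max_sum_bounded hg; rewrite meanB ?mean_cst//; last exact: L1_cst.
move=> /(_ _)[|]; first by rewrite /c; lra.
move=> A [mA A0 hA]; exists A; split=> // x /= hx; apply: hA => /= -[K hK]; apply: hx.
exists (Num.truncn (2 * `|K| / e)).+1 => n Nn.
have n0 : 0 < n%:R :> R by rewrite ltr0n (leq_trans _ Nn).
have := le_trans (sum_le_max_sum _ n x) (hK n).
rewrite sumrB sumr_const_nat subn0 => h.
rewrite ler_pdivrMl//.
have : 2 * `|K| / e <= n%:R.
  by rewrite ltW// (lt_le_trans (truncnS_gt _))// ler_nat.
rewrite ler_pdivrMr// => h2; have := ler_norm K.
by move: h; rewrite -[c *+ n]mulr_natl /c; lra.
Qed.

Lemma birkhoff f : L1 mu f ->
  {ae mu, forall x, forall e, 0 < e -> exists N, forall n, (N <= n)%N ->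
     `|n%:R^-1 * (\sum_(1 <= k < n.+1) f (iter k S x)) - \int[mu]_x f x| <= e}.
Proof.
move=> hf; apply: ae_forall_pos => [e e' x ee' [N hN]|e e0].
  by exists N => n /hN h; rewrite (le_trans h).
(* The sums start at [k = 1], hence [f] is composed with [S]; the lower bound is the upper bound for
   the opposite function. *)
have hfS := L1_shift hf; have hfSN := L1Z (- 1) hfS.
have hu := birkhoff_upper hfS e0; have hl := birkhoff_upper hfSN e0.
apply: filterS2 hu hl => x [N1 h1] [N2 h2]; exists (maxn N1 N2) => n.
rewrite geq_max => /andP[/h1 {}h1 /h2 {}h2].
move: h1 h2; rewrite meanZ// mean_shift// -mulr_sumr mulrCA !mulN1r.
rewrite big_add1/= ler_norml => h1 h2.
by rewrite lerBrDl lerBlDr; apply/andP; split; [move: h2; lra | move: h1; lra].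
Qed.


End Birkhoff.

(** * Ergodic averages of vectors, uniformly over a family of functionals *)

Section VectorBirkhoff.
Context {R : realType} {d : measure_display} {E : measurableType d}.
Variables (mu : probability E R) (S : E -> E).
Hypothesis erg : ergodic mu S.
Context {V : lmodType R[i]}.
Variable L : set (V -> R).
Hypothesis LD : forall l u v, L l -> l (u + v) = l u + l v.
Hypothesis LZ : forall l r v, L l -> l (r%:C *: v) = r * l v.
Hypothesis LN : forall l, L l -> L (fun v => - l v).

Definition average (F : E -> V) (n : nat) (x : E) : V :=
  (n%:R^-1 : R)%:C *: \sum_(1 <= k < n.+1) F (iter k S x).

(** The bound [M i] is uniform over [L], so that convergence of the scalar coefficients is uniform
    over [L] as well. *)
Definition simple_map (G : E -> V) : Prop :=
  exists (I : Type) (s : seq I) (c : I -> E -> R) (v : I -> V) (M : I -> R),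
  [/\ forall i, L1 mu (c i), forall i l, L l -> `|l (v i)| <= M i &
      forall x, G x = \sum_(i <- s) (c i x)%:C *: v i].

Lemma functional0 l : L l -> l 0 = 0.
Proof. by move=> Ll; rewrite -(scale0r 0) -(rmorph0 (real_complex R)) LZ// mul0r. Qed.

Lemma functionalB l u v : L l -> l (u - v) = l u - l v.
Proof.
move=> Ll; rewrite LD//; congr (_ + _); apply/eqP.
by rewrite -subr_eq0 opprK -LD// addNr functional0.
Qed.

Lemma functional_sum l (I : Type) (s : seq I) (f : I -> V) : L l ->
  l (\sum_(i <- s) f i) = \sum_(i <- s) l (f i).
Proof.
move=> Ll; elim: s => [|i s IH]; first by rewrite !big_nil functional0.
by rewrite !big_cons LD// IH.
Qed.

Let avg (f : E -> R) n x := n%:R^-1 * (\sum_(1 <= k < n.+1) f (iter k S x)).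

Lemma functional_average l F n x : L l -> l (average F n x) = avg (l \o F) n x.
Proof. by move=> Ll; rewrite /average LZ// functional_sum. Qed.

(** The scalar theorem is applied to [g] and to the coefficients [c i] only, none of which depends
    on [l]. *)
Lemma vector_birkhoff (F : E -> V) (C : V) :
  (forall l, L l -> L1 mu (l \o F) /\ \int[mu]_x l (F x) = l C) ->
  (forall e : R, 0 < e -> exists G g, [/\ simple_map G, L1 mu g,
     \int[mu]_x g x <= e & forall l x, L l -> l (F x - G x) <= g x]) ->
  {ae mu, forall x, forall e, 0 < e -> exists N, forall n, (N <= n)%N ->
     forall l, L l -> l (average F n x - C) <= e}.
Proof.
move=> weakC approx; apply: ae_forall_pos => [e e' x ee' [N hN]|e e0].
  by exists N => n /hN h l /h h'; rewrite (le_trans h').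
(* Four errors: the mean of [g] twice (once for the averages, once for [l C]), the fluctuation of
   the averages of [g], and that of the coefficients. *)
have e4 : 0 < e / 4 by rewrite divr_gt0.
have [G [g [[I [s [c [v [M [cL1 vM GE]]]]]] gL1 ge FG]]] := approx _ e4.
have sum_small : {ae mu, forall x, forall e, 0 < e -> exists N, forall n, (N <= n)%N ->
    \sum_(i <- s) `|avg (c i) n x - \int[mu]_x c i x| * M i <= e}.
  elim: s {GE} => [|i s IH].
    by apply: aeW => x t t0; exists 0%N => n _; rewrite big_nil ltW.
  have := birkhoff erg (cL1 i); apply: filterS2 IH => x h1 h2 t t0.
  have t2 : 0 < t / 2 by rewrite divr_gt0.
  have t3 : 0 < t / 2 / (`|M i| + 1) by rewrite divr_gt0// ltr_wpDl.
  have [N1 {}h1] := h1 _ t2; have [N2 {}h2] := h2 _ t3.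
  exists (maxn N1 N2) => n; rewrite geq_max => /andP[/h1 {}h1 /h2 {}h2].
  rewrite big_cons [leRHS]splitr lerD//.
  move: h2; rewrite ler_pdivlMr ?ltr_wpDl// => h2; apply: le_trans h2.
  by rewrite ler_wpM2l// (le_trans (ler_norm _))// lerDl.
apply: filterS2 sum_small (birkhoff erg gL1) => x /(_ _ e4)[N1 h1] /(_ _ e4)[N2 h2].
exists (maxn N1 N2) => n; rewrite geq_max => /andP[/h1 {}h1 /h2 {}h2] l Ll.
have [lF lC] := weakC l Ll.
have lG y : l (G y) = \sum_(i <- s) c i y * l (v i).
  by rewrite GE functional_sum//; apply: eq_bigr => i _; rewrite LZ.
have lGL1 : L1 mu (fun y => \sum_(i <- s) c i y * l (v i)).
  apply: L1_sum => i; under [X in L1 _ X]eq_fun do rewrite mulrC.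
  exact: L1Z.
have meanG : \int[mu]_y (\sum_(i <- s) c i y * l (v i)) =
    \sum_(i <- s) \int[mu]_y c i y * l (v i).
  rewrite mean_sum; last first.
    by move=> i; under [X in L1 _ X]eq_fun do rewrite mulrC; exact: L1Z.
  apply: eq_bigr => i _; rewrite mulrC -meanZ//.
  by apply: eq_Rintegral => y _; rewrite mulrC.
(* Applying the approximation bound to [- l] gives [l (G y) - g y <= l (F y)], which is then
   integrated. *)
have lowC : \sum_(i <- s) \int[mu]_y c i y * l (v i) - \int[mu]_y g y <= l C.
  rewrite -meanG -meanB// -lC; apply: mean_le => //; first exact: L1B.
  move=> y; rewrite lerBlDr -lerBlDl -lG -functionalB//.
  have := FG _ y (LN Ll); rewrite !functionalB//=; lra.
have upF : avg (l \o F) n x <= avg g n x + \sum_(i <- s) avg (c i) n x * l (v i).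
  have -> : \sum_(i <- s) avg (c i) n x * l (v i) =
      avg (fun y => \sum_(i <- s) c i y * l (v i)) n x.
    rewrite /avg exchange_big mulr_sumr; apply: eq_bigr => i _.
    by rewrite -mulr_suml mulrA.
  rewrite /avg -mulrDr ler_wpM2l ?invr_ge0// -big_split/= ler_sum// => k _.
  rewrite -lerBlDr -lG -functionalB//; exact: FG.
have cmp : \sum_(i <- s) avg (c i) n x * l (v i) -
    \sum_(i <- s) \int[mu]_y c i y * l (v i) <= e / 4.
  apply: le_trans h1; rewrite -sumrB ler_sum// => i _.
  rewrite -mulrBl (le_trans (ler_norm _))// normrM ler_wpM2l//; exact: vM.
rewrite functionalB// functional_average//.
by move: h2; rewrite ler_norml -/(avg g n x) => /andP[_ h2]; lra.
Qed.

End VectorBirkhoff.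

(** * Approximation by simple functions *)

Section BorelHilbert.
Context {R : realType} {H : hilbertType R}.

Lemma open_rnormP (A : set H) :
  (forall y, A y -> exists2 e : R, 0 < e & forall z, rnorm (z - y) < e -> A z) -> open A.
Proof.
move=> h; rewrite openE => y /h[e e0 he]; apply/nbhs_ballP.
exists e%:C => /=; first by rewrite ltcR.
move=> z; rewrite -ball_normE /ball_/= distrC rnormE ltcR; exact: he.
Qed.

Lemma borel_measurable_continuous (f : H -> R) :
  (forall y e, 0 < e -> exists2 e' : R, 0 < e' &
     forall z, rnorm (z - y) < e' -> `|f z - f y| < e) ->
  measurable_fun setT (f : borelType H -> R).
Proof.
move=> cf; apply: (measurability (@RGenOInfty.G R)).
  exact: RGenOInfty.measurableE.
move=> _ [_ [a ->] <-]; rewrite setTI; apply: sub_sigma_algebra.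
apply: open_rnormP => y /=; rewrite in_itv/= andbT => fa.
have [|e e0 he] := cf y (f y - a); first by rewrite subr_gt0.
exists e => // z /he; rewrite in_itv/= andbT.
by rewrite ltr_norml => /andP[+ _]; lra.
Qed.

Lemma borel_measurable_rnormB (c : H) :
  measurable_fun setT ((fun y => rnorm (y - c)) : borelType H -> R).
Proof.
apply: borel_measurable_continuous => y e e0; exists e => // z.
apply: le_lt_trans; rewrite ler_norml; apply/andP; split.
  by rewrite lerNl opprB lerBlDr [rnorm (z - y)]rnorm_distC rnorm_distD.
by rewrite lerBlDr rnorm_distD.
Qed.

Lemma borel_measurable_rip (c : H) :
  measurable_fun setT ((fun y => rip y c) : borelType H -> R).
Proof.
apply: borel_measurable_continuous => y e e0.
exists (e / (rnorm c + 1)); first by rewrite divr_gt0// ltr_wpDl ?rnorm_ge0.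
move=> z; rewrite ltr_pdivlMr ?ltr_wpDl ?rnorm_ge0// -ripBl; apply: le_lt_trans.
by rewrite (le_trans (rip_abs _ _))// ler_wpM2l ?rnorm_ge0// lerDl.
Qed.

Definition borel_simple (phi : H -> H) : Prop :=
  exists (I : Type) (s : seq I) (A : I -> set (borelType H)) (v : I -> H),
  (forall i, measurable (A i)) /\
  forall y, phi y = \sum_(i <- s) (\1_(A i) y : R)%:C *: v i.

Lemma borel_simple0 : borel_simple (fun=> 0).
Proof. by exists unit, [::], (fun=> set0), (fun=> 0); split=> // y; rewrite big_nil. Qed.

(** Removing [J] from the old pieces lets a single sum express the case distinction. *)
Lemma borel_simple_if (J : set (borelType H)) (c : H) phi :
  measurable J -> borel_simple phi ->
  borel_simple (fun y => if y \in J then c else phi y).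
Proof.
move=> mJ [I [s [A [v [mA phiE]]]]].
exists (option I), (None :: map some s), (fun o => if o is Some i then A i `\` J else J),
  (fun o => if o is Some i then v i else c).
split=> [[i|]//|y]; first exact: measurableD.
rewrite big_cons big_map indicE; case: ifPn => yJ /=.
  rewrite rmorph1 scale1r big1 ?addr0// => i _.
  by rewrite indicE in_setD yJ andbF rmorph0 scale0r.
rewrite rmorph0 scale0r add0r phiE; apply: eq_bigr => i _.
by rewrite !indicE in_setD yJ andbT.
Qed.

Section Quantization.
Variable D : nat -> H.

(* A point closest to [y] among 0 and the first [m] terms of [D]; including 0
   makes [rnorm (y - nearest m y)] dominated by [rnorm y]. *)
Fixpoint nearest (m : nat) (y : H) : H :=
  if m is m'.+1 then
    if y \in [set z | rnorm (z - D m') < rnorm (z - nearest m' z)] then D m'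
    else nearest m' y
  else 0.

Lemma nearestS m y : rnorm (y - nearest m.+1 y) =
  Num.min (rnorm (y - nearest m y)) (rnorm (y - D m)).
Proof.
rewrite /=; case: ifPn => [|]; rewrite ?notin_setE ?in_setE/= => h.
  by rewrite min_r// ltW.
by rewrite min_l// leNgt; exact/negP.
Qed.

Lemma nearest_homo m n y : (m <= n)%N -> rnorm (y - nearest n y) <= rnorm (y - nearest m y).
Proof.
move=> /subnK<-; elim: (n - m)%N => // k IH.
by rewrite addSn nearestS (le_trans _ IH)// ge_min lexx.
Qed.

Lemma nearest_le m y : rnorm (y - nearest m y) <= rnorm y.
Proof. by have := @nearest_homo 0 m y isT; rewrite /= subr0. Qed.

Lemma nearest_simple m : borel_simple (nearest m) /\
  measurable_fun setT ((fun y => rnorm (y - nearest m y)) : borelType H -> R).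
Proof.
elim: m => [|m [sm mm]].
  split; first exact: borel_simple0.
  exact: borel_measurable_rnormB.
split.
  apply: borel_simple_if => //; rewrite -[X in measurable X]setTI.
  by apply: measurable_fun_ltr => //; exact: borel_measurable_rnormB.
rewrite [X in measurable_fun _ X](_ : _ = (fun y : borelType H =>
  Num.min (rnorm (y - nearest m y)) (rnorm (y - D m)))); last first.
  by apply/funext => y; exact: nearestS.
by apply: measurable_minr => //; exact: borel_measurable_rnormB.
Qed.

End Quantization.

Lemma separable_sequence : separable H -> exists D : nat -> H,
  forall y (e : R), 0 < e -> exists m, rnorm (y - D m) < e.
Proof.
move=> [B cB dB]; have /countable_injP[f finj] := cB.
(* Indices outside the image of [f] get the default value 0, which does not affect density. *)
exists (fun m => xget 0 [set z | B z /\ f z = m]) => y e e0.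
have [||z [ye Bz]] := dB [set z | rnorm (z - y) < e].
- by exists y; rewrite /= subrr rnorm0.
- apply: open_rnormP => z /= ze; exists (e - rnorm (z - y)); first by rewrite subr_gt0.
  by move=> w; rewrite ltrBrDr; apply: le_lt_trans; rewrite rnorm_distD.
exists (f z).
have [Bz' fz'] : [set w | B w /\ f w = f z] (xget 0 [set w | B w /\ f w = f z]).
  by apply: (xgetPex 0); exists z.
by rewrite (finj _ _ (mem_set Bz') (mem_set Bz) fz') rnorm_distC.
Qed.

(** By density the distances [r m] decrease to 0 pointwise, and they are dominated by [rnorm (u x)];
    dominated convergence applies to their squares. *)
Lemma simple_approximation {d} {E : measurableType d} (mu : probability E R)
    (u : E -> borelType H) (e : R) :
  separable H -> measurable_fun setT u -> L1 mu (fun x => rnorm (u x : H) ^+ 2) ->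
  0 < e ->
  exists phi, [/\ borel_simple phi,
    measurable_fun setT ((fun y => rnorm (y - phi y)) : borelType H -> R),
    L1 mu (fun x => rnorm ((u x : H) - phi (u x)) ^+ 2) &
    \int[mu]_x rnorm ((u x : H) - phi (u x)) ^+ 2 <= e].
Proof.
move=> /separable_sequence[D hD] mu_ u2 e0.
pose r m x := rnorm ((u x : H) - nearest D m (u x)).
have mr m : measurable_fun setT (fun x => r m x ^+ 2).
  apply: measurable_funX; exact: measurableT_comp (nearest_simple D m).2 mu_.
have rL1 m : L1 mu (fun x => r m x ^+ 2).
  apply: (@L1_le _ _ _ _ _ (fun x => rnorm (u x : H) ^+ 2)) => // x.
  rewrite ger0_norm ?sqr_ge0// lerXn2r ?nnegrE ?rnorm_ge0//; exact: nearest_le.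
have [|||||_ _ cvg_int] := @dominated_convergence _ _ _ mu setT measurableT
  (fun n x => (r n x ^+ 2)%:E) (fun=> 0%E) (fun x => (rnorm (u x : H) ^+ 2)%:E).
- by move=> n; exact/measurable_EFinP.
- exact: measurable_cst.
- apply: aeW => x _; apply/fine_cvgP; split; first by exists 0%N.
  apply/cvgrPdist_lt => t t0.
  have t1 : 0 < Num.sqrt t by rewrite sqrtr_gt0.
  have [m hm] := hD (u x) _ t1; exists m.+1 => // n /= mn.
  rewrite sub0r normrN ger0_norm ?sqr_ge0//.
  rewrite -[ltRHS](sqr_sqrtr (ltW t0)) ltr_pXn2r ?nnegrE ?rnorm_ge0 ?sqrtr_ge0//.
  by rewrite (le_lt_trans (nearest_homo D _ mn))// nearestS gt_min hm orbT.
- exact: u2.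
- apply: aeW => x n _; rewrite lee_fin ger0_norm ?sqr_ge0//.
  rewrite lerXn2r ?nnegrE ?rnorm_ge0//; exact: nearest_le.
move: cvg_int; rewrite integral0 => /fine_cvgP[_ /cvgrPdist_lt/(_ _ e0)[N _ hN]].
exists (nearest D N); split.
- exact: (nearest_simple D N).1.
- exact: (nearest_simple D N).2.
- exact: rL1.
- have := hN N (leqnn N); rewrite /= sub0r normrN => /ltW; apply: le_trans.
  exact: ler_norm.
Qed.

End BorelHilbert.

(** * Lagged products *)

Section Deterministic.
Context {R : realType} {H : hilbertType R}.

Lemma rank_oneDl (x x' y : H) : rank_one (x + x') y = rank_one x y + rank_one x' y.
Proof. by apply/funext => z; rewrite /rank_one scalerDr. Qed.

Lemma rank_oneDr (x y y' : H) : rank_one x (y + y') = rank_one x y + rank_one x y'.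
Proof. by apply/funext => z; rewrite /rank_one ipDr scalerDl. Qed.

Lemma rank_one_real (r s : R) (x y : H) :
  rank_one (r%:C *: x) (s%:C *: y) = (r * s)%:C *: rank_one x y.
Proof.
apply/funext => z; rewrite /rank_one -[RHS]/((r * s)%:C *: (ip z y *: x)).
by rewrite ipZr conj_real !scalerA rmorphM/=; congr (_ *: _); ring.
Qed.

(** With [a] or [b] zero, [j] is the smaller of the two indices; the larger one is [j + maxn a b],
    which is at most [n] exactly when [j <= n - maxn a b]. *)
Lemma sum_diagonal (W : nmodType) (f : nat -> nat -> W) (a b n : nat) :
  (a = 0%N \/ b = 0%N) ->
  \sum_(1 <= k < n.+1) \sum_(1 <= k' < n.+1 | k%:Z - k'%:Z == a%:Z - b%:Z) f k k' =
  \sum_(1 <= j < (n - maxn a b).+1) f (j + a)%N (j + b)%N.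
Proof.
have cut c : forall g : nat -> W,
    \sum_(1 <= k < n.+1) (if (1 <= k + c < n.+1)%N then g k else 0) =
    \sum_(1 <= k < (n - c).+1) g k.
  move=> g; rewrite [RHS](big_nat_widen 1 (n - c).+1 n.+1) ?ltnS ?leq_subr//.
  rewrite -big_mkcond/= big_nat_cond [RHS]big_nat_cond; apply: eq_bigl => k.
  by case: (posnP k) => [->//|k0]; rewrite addn_gt0 k0/=; congr (_ && _); lia.
have pick1 (g : nat -> W) i : (if (1 <= i < n.+1)%N then g i else 0) =
    \sum_(1 <= j < n.+1 | j == i) g j by rewrite big_nat1_eq.
case=> ->.
- rewrite max0n -cut; apply: eq_bigr => k _; rewrite addn0 pick1.
  by apply: eq_bigl => k'; lia.
- rewrite maxn0 (exchange_big_dep_nat predT)//= -cut; apply: eq_bigr => k _.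
  rewrite addn0 (pick1 (f^~ k)).
  by apply: eq_bigl => k'; lia.
Qed.

End Deterministic.

Section CenteredSums.
Context {R : realType} {H : hilbertType R}.

(** Three errors of size [e / 3]: convergence of the averages over [p = n - c] terms, the
    normalization by [n] instead of [p], and the recentering by [dl n]. *)
Lemma centered_sum_nuclear (y : nat -> H) (dl : nat -> H) (a b c : nat)
    (C : H -> H) (B K : R) :
  (forall e, 0 < e -> exists N, forall n, (N <= n)%N -> rnorm (dl n) <= e) ->
  (exists N, forall p, (N <= p)%N ->
     p%:R^-1 * (\sum_(1 <= j < p.+1) rnorm (y (j + a)%N)) <= B) ->
  (exists N, forall p, (N <= p)%N ->
     p%:R^-1 * (\sum_(1 <= j < p.+1) rnorm (y (j + b)%N)) <= B) ->
  nuclear_le C K ->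
  (forall e, 0 < e -> exists N, forall p, (N <= p)%N -> nuclear_le
     ((p%:R^-1 : R)%:C *: (\sum_(1 <= j < p.+1) rank_one (y (j + a)%N) (y (j + b)%N)) - C) e) ->
  forall e, 0 < e -> exists N, forall n, (N <= n)%N -> nuclear_le
     ((n%:R^-1 : R)%:C *: (\sum_(1 <= j < (n - c).+1)
        rank_one (y (j + a)%N - dl n) (y (j + b)%N - dl n)) - C) e.
Proof.
move=> hdl [Na ha] [Nb hb] CK hA e e0.
have B0 : 0 <= B.
  apply: le_trans (ha Na (leqnn _)); rewrite mulr_ge0 ?invr_ge0// sumr_ge0// => j _.
  exact: rnorm_ge0.
have K0 := nuclear_le_ge0 CK.
have e3 : 0 < e / 3 by rewrite divr_gt0.
(* The bound 1 on [|dl n|] replaces its square by itself, so recentering costs at most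
   [|dl n| * (2 * B + 1)] per term on average. *)
have e1 : 0 < Num.min 1 (e / 3 / (2 * B + 1)).
  by rewrite lt_min ltr01 divr_gt0// ltr_wpDl// mulr_ge0.
have [N1 h1] := hdl _ e1; have [N2 h2] := hA _ e3.
pose N3 := (Num.truncn (c%:R * K / (e / 3))).+1.
exists (N1 + Na + Nb + N2 + N3 + 1 + c)%N => n Nn.
pose p := (n - c)%N.
have nE : n = (p + c)%N by rewrite subnK//; lia.
have p0 : 0 < p%:R :> R by rewrite ltr0n /p; lia.
have n0 : 0 < n%:R :> R by rewrite ltr0n; lia.
have pn : p%:R <= n%:R :> R by rewrite ler_nat leq_subr.
have {}h1 := h1 n ltac:(lia); have {}h2 := h2 p ltac:(rewrite /p; lia).
have {}ha := ha p ltac:(rewrite /p; lia); have {}hb := hb p ltac:(rewrite /p; lia).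
have h3 : (1 - p%:R / n%:R) * K <= e / 3.
  have -> : 1 - p%:R / n%:R = c%:R / n%:R :> R.
    by rewrite {1 2}nE natrD; field; rewrite -natrD -nE gt_eqF.
  rewrite mulrAC ler_pdivrMr// -ler_pdivrMl// mulrC.
  by rewrite ltW// (lt_le_trans (truncnS_gt _))// ler_nat -/N3; lia.
move: h1; rewrite le_min => /andP[d1 d2].
rewrite -/p => l hl.
pose D := rnorm (dl n).
have D0 : 0 <= D by exact: rnorm_ge0.
have lD := trace_functional_add _ _ hl; have lZ := trace_functional_scale _ _ hl.
have lsum (F : nat -> H -> H) q : l (\sum_(1 <= j < q.+1) F j) = \sum_(1 <= j < q.+1) l (F j).
  exact: (functional_sum (L := trace_functional) (fun l u v => @trace_functional_add _ _ l u v)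
            (fun l r v => @trace_functional_scale _ _ l r v)).
have lB u v : l (u - v) = l u - l v.
  exact: (functionalB (L := trace_functional) (fun l u v => @trace_functional_add _ _ l u v)
            (fun l r v => @trace_functional_scale _ _ l r v)).
have := h2 l hl; rewrite !lB !lZ !lsum => {}h2.
have lC : - l C <= K by exact: CK _ (trace_functional_opp hl).
have step j : l (rank_one (y (j + a)%N - dl n) (y (j + b)%N - dl n)) <=
   l (rank_one (y (j + a)%N) (y (j + b)%N)) +
   D * (rnorm (y (j + b)%N) + rnorm (y (j + a)%N) + D).
  rewrite rank_oneDl lD; rewrite rank_oneDr lD.
  have := nuclear_le_rank_one (y (j + a)%N) (- dl n) hl.
  have := nuclear_le_rank_one (- dl n) (y (j + b)%N - dl n) hl.
  have := rnormB (y (j + b)%N) (dl n); rewrite !rnormN -/D.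
  move: (rnorm (_ - _)) (rnorm (y _)) (rnorm (y _)) => u v w.
  move=> u_le; have := ler_wpM2l D0 u_le; lra.
have sum_le : \sum_(1 <= j < p.+1) l (rank_one (y (j + a)%N - dl n) (y (j + b)%N - dl n)) <=
   \sum_(1 <= j < p.+1) l (rank_one (y (j + a)%N) (y (j + b)%N)) + p%:R * (D * (2 * B + 1)).
  rewrite (le_trans (ler_sum _ (fun j _ => step j)))// big_split/= lerD2l.
  rewrite -mulr_sumr !big_split/= sumr_const_nat subSS subn0 -mulr_natl.
  move: ha hb; rewrite !ler_pdivrMl// => ha hb.
  rewrite [leRHS]mulrCA ler_wpM2l//.
  have : p%:R * D <= p%:R * 1 by rewrite ler_pM2l//.
  lra.
have DB : D * (2 * B + 1) <= e / 3.
  by rewrite -ler_pdivlMr// ltr_wpDl// mulr_ge0.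
set s2 := \sum_(1 <= j < p.+1) l (rank_one (y (j + a)%N) (y (j + b)%N)) in sum_le h2.
set s1 := \sum_(1 <= j < p.+1) l _ in sum_le *.
have h4 : n%:R^-1 * s1 <= n%:R^-1 * (s2 + p%:R * (D * (2 * B + 1))) by rewrite ler_pM2l ?invr_gt0.
have t1 : p%:R / n%:R <= 1 :> R by rewrite ler_pdivrMr// mul1r.
have t0 : 0 <= p%:R / n%:R :> R by rewrite divr_ge0.
have h5 : n%:R^-1 * (s2 + p%:R * (D * (2 * B + 1))) - l C =
   p%:R / n%:R * (p%:R^-1 * s2 - l C) + (1 - p%:R / n%:R) * (- l C) +
   p%:R / n%:R * (D * (2 * B + 1)).
  by field; rewrite !gt_eqF.
have h6 : p%:R / n%:R * (p%:R^-1 * s2 - l C) <= e / 3.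
  have := ler_wpM2l t0 h2; have := ler_wpM2r (ltW e3) t1; lra.
have h7 : (1 - p%:R / n%:R) * (- l C) <= e / 3.
  by apply: le_trans h3; rewrite ler_wpM2l// subr_ge0.
have h8 : p%:R / n%:R * (D * (2 * B + 1)) <= e / 3.
  have := ler_wpM2l t0 DB; have := ler_wpM2r (ltW e3) t1; lra.
lra.
Qed.

End CenteredSums.

(** * The process on path space *)

Section WeakMean.
Context {R : realType} {H : hilbertType R}.

Lemma rip_rank_one (u v y z : H) : rip (rank_one u v y) z =
  rip v y * rip u z + rip v ('i%C *: y) * rip u ('i%C *: z).
Proof.
rewrite {1}/rip /rank_one ipZl cReM (ip_conjC v y) cRe_conj cIm_conj !Im_ip.
by rewrite /rip; ring.
Qed.

Lemma rip_rank_one_le (u v y z : H) : `|rip (rank_one u v y) z| <=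
  (rnorm u ^+ 2 + rnorm v ^+ 2) * (rnorm y * rnorm z).
Proof.
rewrite rip_rank_one (le_trans (ler_normD _ _))// !normrM.
have := ler_pM (normr_ge0 _) (normr_ge0 _) (rip_abs v y) (rip_abs u z).
have := ler_pM (normr_ge0 _) (normr_ge0 _) (rip_abs v ('i%C *: y)) (rip_abs u ('i%C *: z)).
rewrite !rnormMi => h1 h2; apply: le_trans (lerD h2 h1) _.
have yz : 0 <= rnorm y * rnorm z by rewrite mulr_ge0 ?rnorm_ge0.
have := mulr_ge0 yz (sqr_ge0 (rnorm u - rnorm v)); lra.
Qed.

Lemma rip_scale_conj (a : R[i]) (x y : H) : rip (a *: x) y = rip x (Num.conj a *: y).
Proof. by rewrite /rip ipZl ipZr conjCK. Qed.

Lemma borel_simpleB (phi : H -> H) (m : H) :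
  borel_simple phi -> borel_simple (fun y => phi y - m).
Proof.
move=> [I [s [A [v [mA phiE]]]]].
exists (option I), (None :: map some s), (fun o => if o is Some i then A i else setT),
  (fun o => if o is Some i then v i else - m).
split=> [[i|]//|y]; rewrite big_cons big_map indicT rmorph1 scale1r addrC.
by rewrite phiE.
Qed.

Context {d : measure_display} {E : measurableType d} (mu : probability E R).

(** A weak integral of [Z], obtained by representing the functional [z |-> E <Z, z>]. *)
Lemma weak_mean (Z : E -> H) (K : R) :
  (forall z, L1 mu (fun x => rip (Z x) z)) ->
  (forall z, \int[mu]_x rip (Z x) z <= K * rnorm z) ->
  exists m, forall z, rip m z = \int[mu]_x rip (Z x) z.
Proof.
move=> ZL1 ZK.
apply: (@coercive_representation R H id (fun z => \int[mu]_x rip (Z x) z) 1 1 K) => //.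
- by move=> x; rewrite mul1r.
- by move=> x; rewrite mul1r ripxx.
- by move=> x y; rewrite -meanD//; apply: eq_Rintegral => w _; rewrite ripDr.
- by move=> r x; rewrite -meanZ//; apply: eq_Rintegral => w _; rewrite ripZr.
Qed.

End WeakMean.

Section PathSpace.
Context {R : realType} {H : hilbertType R}.

Lemma measurable_coord (t : int) :
  measurable_fun setT ((fun x => x t) : path_space H -> borelType H).
Proof.
move=> _ B mB; rewrite setTI; apply: sub_sigma_algebra.
by exists t, B.
Qed.

Lemma measurable_at (g : H -> R) (t : int) :
  measurable_fun setT (g : borelType H -> R) ->
  measurable_fun setT ((fun x => g (x t)) : path_space H -> R).
Proof. by move=> mg; exact: measurableT_comp mg (measurable_coord t). Qed.

Lemma iter_shift (k : nat) (x : path_space H) (t : int) :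
  iter k (@Defs.shift R H) x t = x (t + k%:Z).
Proof.
elim: k t => [|k IH] t; first by rewrite addr0.
by rewrite iterS /Defs.shift IH -addrA; congr (x (t + _)); rewrite PoszD addrC.
Qed.

Lemma measurable_ripB (m z : H) :
  measurable_fun setT ((fun y => rip (y - m) z) : borelType H -> R).
Proof.
under [X in measurable_fun _ X]eq_fun do rewrite ripBl.
apply: measurable_funB; last exact: measurable_cst.
exact: borel_measurable_rip.
Qed.

Section ErgodicPath.
Variable Q : probability (path_space H) R.
Hypothesis erg : ergodic Q (@Defs.shift R H).
Hypothesis sep : separable H.
Hypothesis L2 : L1 Q (fun x => rnorm (x 0) ^+ 2).

(** Time [t] is reached by [t] iterations of the shift, whence [t : nat]. *)
Lemma L1_at (g : H -> R) (t : nat) :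
  L1 Q (fun x => g (x 0)) -> L1 Q (fun x => g (x t%:Z)).
Proof.
move=> hg; have := L1_iter erg t hg.
by congr (L1 Q _); apply/funext => x; rewrite iter_shift add0r.
Qed.

Lemma mean_at (g : H -> R) (t : nat) :
  L1 Q (fun x => g (x 0)) -> \int[Q]_x g (x t%:Z) = \int[Q]_x g (x 0).
Proof.
move=> hg; rewrite -(mean_iter erg t hg).
by apply: eq_Rintegral => x _; rewrite iter_shift add0r.
Qed.

Lemma L1_sqnormB (m : H) : L1 Q (fun x => rnorm (x 0 - m) ^+ 2).
Proof.
apply: (@L1_le _ _ _ _ _ (fun x : path_space H => 2 * rnorm (x 0) ^+ 2 + 2 * rnorm m ^+ 2)).
- apply: (measurable_at (g := fun y => rnorm (y - m) ^+ 2)).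
  by apply: measurable_funX; exact: borel_measurable_rnormB.
- move=> x; rewrite ger0_norm ?sqr_ge0//.
  have := rnormB (x 0) m; have := rnorm_ge0 (x 0 - m); have := sqr_ge0 (rnorm (x 0) - rnorm m).
  nra.
- apply: L1D; [exact: L1Z | exact: L1_cst].
Qed.

Lemma L1_normB (m : H) : L1 Q (fun x => rnorm (x 0 - m)).
Proof.
apply: (@L1_le _ _ _ _ _ (fun x : path_space H => 1 + rnorm (x 0 - m) ^+ 2)).
- apply: (measurable_at (g := fun y => rnorm (y - m))).
  exact: borel_measurable_rnormB.
- move=> x; rewrite ger0_norm ?rnorm_ge0//.
  by have := sqr_ge0 (rnorm (x 0 - m) - 1); have := sqr_ge0 (rnorm (x 0 - m)); lra.
- apply: L1D; [exact: L1_cst | exact: L1_sqnormB].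
Qed.

Lemma L1_ripB (m z : H) : L1 Q (fun x => rip (x 0 - m) z).
Proof.
apply: (@L1_le _ _ _ _ _ (fun x : path_space H => rnorm z * rnorm (x 0 - m))).
- apply: (measurable_at (g := fun y => rip (y - m) z)); exact: measurable_ripB.
- by move=> x; rewrite mulrC rip_abs.
- by apply: L1Z; exact: L1_normB.
Qed.

Lemma path_mean : exists m : H, forall z, \int[Q]_x rip (x 0 - m) z = 0.
Proof.
have h0 z : L1 Q (fun x => rip (x 0) z).
  by have := L1_ripB 0 z; congr (L1 Q _); apply/funext => x; rewrite subr0.
have n0 : L1 Q (fun x => rnorm (x 0)).
  by have := L1_normB 0; congr (L1 Q _); apply/funext => x; rewrite subr0.
have [|m hm] := @weak_mean R H _ _ Q (fun x => x 0) (\int[Q]_x rnorm (x 0)) h0.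
  move=> z; rewrite mulrC -meanZ//; apply: mean_le => //; first exact: L1Z.
  by move=> x; rewrite mulrC rip_le.
exists m => z; under eq_Rintegral do rewrite ripBl.
by rewrite meanB ?mean_cst ?hm ?subrr//; exact: L1_cst.
Qed.

Lemma path_mean_birkhoff (m : H) : (forall z, \int[Q]_x rip (x 0 - m) z = 0) ->
  {ae Q, forall x, forall e, 0 < e -> exists N, forall n, (N <= n)%N ->
     rnorm (average (@Defs.shift R H) (fun x => x 0 - m) n x) <= e}.
Proof.
move=> hm.
pose L := [set l : H -> R | exists2 f, rnorm f <= 1 & l = rip^~ f].
have LD l u v : L l -> l (u + v) = l u + l v by case=> f _ ->; rewrite ripDl.
have LZ l r v : L l -> l (r%:C *: v) = r * l v by case=> f _ ->; rewrite ripZl.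
have LN l : L l -> L (fun v => - l v).
  case=> f f1 ->; exists (- f); first by rewrite rnormN.
  by apply/funext => v; rewrite ripNr.
suff : {ae Q, forall x, forall e, 0 < e -> exists N, forall n, (N <= n)%N ->
    forall l, L l -> l (average (@Defs.shift R H) (fun x => x 0 - m) n x - 0) <= e}.
  apply: filterS => x hx e e0; have [N hN] := hx e e0; exists N => n /hN {}hN.
  set v := average _ _ _ _ in hN *.
  have [->|v0] := eqVneq (rnorm v) 0; first exact: ltW.
  have v1 : 0 < rnorm v by rewrite lt_neqAle eq_sym v0 rnorm_ge0.
  (* Testing against the normalized average recovers its norm. *)
  have := hN (rip^~ (((rnorm v)^-1)%:C *: v)); rewrite /= subr0 ripZr ripxx expr2 mulKf//.
  apply; exists (((rnorm v)^-1)%:C *: v) => //.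
  by rewrite rnormZ ger0_norm ?invr_ge0 ?rnorm_ge0// mulVf.
apply: (vector_birkhoff erg LD LZ LN).
- move=> _ [f _ ->]; split; first exact: L1_ripB.
  by rewrite rip0l hm.
- move=> e e0.
  (* The approximation controls squares only; [r <= (e + r^2 / e) / 2] then bounds the mean error by
     [e]. *)
  have e2 : 0 < e ^+ 2 by rewrite exprn_gt0.
  have [phi [sphi mphi rL1 re]] := simple_approximation sep (measurable_coord 0) L2 e2.
  have [I [s [A [v [mA phiE]]]]] := borel_simpleB m sphi.
  exists (fun x : path_space H => phi (x 0) - m),
    (fun x : path_space H => 2^-1 * (e + e^-1 * rnorm (x 0 - phi (x 0)) ^+ 2)).
  split.
  + exists I, s, (fun i (x : path_space H) => \1_(A i) (x 0)), v, (fun i => rnorm (v i)); split.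
    * move=> i; have mB : measurable [set x : path_space H | A i (x 0)].
        by have := measurable_coord 0 measurableT (mA i); rewrite setTI.
      have := integrable_indic Q mB; congr (L1 Q _).
    * move=> i _ [f f1 ->]; rewrite (le_trans (rip_abs _ _))//.
      by rewrite ler_piMr ?rnorm_ge0.
    * by move=> x; rewrite phiE.
  + by apply: L1Z; apply: L1D; [exact: L1_cst | exact: L1Z].
  + rewrite meanZ; last by apply: L1D; [exact: L1_cst | exact: L1Z].
    rewrite meanD; [|exact: L1_cst|exact: L1Z].
    by rewrite mean_cst meanZ// ler_pdivrMl// mulr_natl mulr2n lerD2l ler_pdivrMl//.
  + move=> _ x [f f1 ->]; rewrite opprB addrA subrK.
    rewrite (le_trans (rip_le _ _))//; set r := rnorm (x 0 - _).
    have r0 : 0 <= r by exact: rnorm_ge0.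
    have h : r * rnorm f <= r by rewrite ler_piMr.
    apply: le_trans h _; rewrite ler_pdivlMl// -(ler_pM2l e0) mulrDr mulVKf ?gt_eqF//.
    have := sqr_ge0 (e - r); lra.
Qed.

End ErgodicPath.
End PathSpace.

(** * The covariance operator on path space and the averages of lagged products *)

Section PathCovariance.
Context {R : realType} {H : hilbertType R}.
Variable Q : probability (path_space H) R.
Hypothesis erg : ergodic Q (@Defs.shift R H).
Hypothesis sep : separable H.
Hypothesis L2 : L1 Q (fun x => rnorm (x 0) ^+ 2).
Variables (m : H) (a b : nat).

Definition lag_product (x : path_space H) : H -> H :=
  rank_one (x a%:Z - m) (x b%:Z - m).

Definition lag_sqnorm (x : path_space H) : R :=
  rnorm (x a%:Z - m) ^+ 2 + rnorm (x b%:Z - m) ^+ 2.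

Lemma L1_lag_sqnorm : L1 Q lag_sqnorm.
Proof.
apply: L1D.
- exact: (L1_at erg (g := fun y => rnorm (y - m) ^+ 2) _ (L1_sqnormB L2 m)).
- exact: (L1_at erg (g := fun y => rnorm (y - m) ^+ 2) _ (L1_sqnormB L2 m)).
Qed.

Lemma measurable_lag_product (y z : H) :
  measurable_fun setT (fun x : path_space H => rip (lag_product x y) z).
Proof.
under [X in measurable_fun _ X]eq_fun do rewrite rip_rank_one.
by apply: measurable_funD; apply: measurable_funM;
  apply: (measurable_at (g := fun u => rip (u - m) _)); exact: measurable_ripB.
Qed.

Lemma L1_lag_product (y z : H) : L1 Q (fun x => rip (lag_product x y) z).
Proof.
apply: (@L1_le _ _ _ _ _ (fun x => rnorm y * rnorm z * lag_sqnorm x)).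
- exact: measurable_lag_product.
- by move=> x; rewrite mulrC; exact: rip_rank_one_le.
- by apply: L1Z; exact: L1_lag_sqnorm.
Qed.

Lemma path_covariance : exists C : H -> H, bounded_op C /\
  forall y z, rip (C y) z = \int[Q]_x rip (lag_product x y) z.
Proof.
pose K := \int[Q]_x lag_sqnorm x.
have K0 : 0 <= K by apply: mean_ge0 => x; rewrite addr_ge0 ?sqr_ge0.
have hK y z : \int[Q]_x rip (lag_product x y) z <= K * rnorm y * rnorm z.
  rewrite -mulrA mulrC -meanZ//; last exact: L1_lag_sqnorm.
  apply: mean_le; first exact: L1_lag_product.
    by apply: L1Z; exact: L1_lag_sqnorm.
  move=> x; rewrite (le_trans (ler_norm _))// (le_trans (rip_rank_one_le _ _ _ _))//.
  by rewrite mulrC.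
have /choice[C hC] : forall y, exists c, forall z,
    rip c z = \int[Q]_x rip (lag_product x y) z.
  by move=> y; apply: weak_mean (L1_lag_product y) (hK y).
exists C; split=> //; split=> [t y y'|].
  (* [rip] is only real-linear, so a complex scalar is moved to the other argument before [hC]
     applies. *)
  apply: rip_eq => z; rewrite [LHS]ripC [RHS]ripC ripDl rip_scale_conj !hC.
  rewrite -meanD; [|exact: L1_lag_product..].
  apply: eq_Rintegral => x _; rewrite -rip_scale_conj -ripDl.
  by rewrite /lag_product (rank_one_bounded _ _).1.
exists K => y.
have [->|y0] := eqVneq (rnorm (C y)) 0; first by rewrite mulr_ge0 ?rnorm_ge0.
have s0 : 0 < rnorm (C y) by rewrite lt_neqAle eq_sym y0 rnorm_ge0.
by rewrite -(ler_pM2r s0) -expr2 -ripxx hC.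
Qed.

Variable C : H -> H.
Hypothesis hC : forall y z, rip (C y) z = \int[Q]_x rip (lag_product x y) z.

Lemma functional_lag_product l : trace_functional l ->
  L1 Q (fun x => l (lag_product x)) /\ \int[Q]_x l (lag_product x) = l C.
Proof.
case=> s [f [_ _ lE]]; split.
  under [X in L1 Q X]eq_fun do rewrite lE.
  by apply: L1_sum => e; exact: L1_lag_product.
under eq_Rintegral do rewrite lE.
rewrite mean_sum; last by move=> e; exact: L1_lag_product.
by rewrite lE; apply: eq_bigr => e _; rewrite hC.
Qed.

Lemma covariance_nuclear : nuclear_le C (\int[Q]_x lag_sqnorm x).
Proof.
move=> l hl; have [lL1 <-] := functional_lag_product hl.
apply: mean_le => //; first exact: L1_lag_sqnorm.
move=> x; apply: le_trans (nuclear_le_rank_one _ _ hl) _; rewrite /lag_sqnorm.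
have := rnorm_ge0 (x a%:Z - m); have := rnorm_ge0 (x b%:Z - m).
have := sqr_ge0 (rnorm (x a%:Z - m) - rnorm (x b%:Z - m)); nra.
Qed.

Lemma lag_product_approximation e : 0 < e -> exists G g,
  [/\ simple_map Q trace_functional G, L1 Q g, \int[Q]_x g x <= e &
     forall l x, trace_functional l -> l (lag_product x - G x) <= g x].
Proof.
move=> e0.
pose K := \int[Q]_x rnorm (x 0 - m) ^+ 2.
have K0 : 0 <= K by apply: mean_ge0 => x; rewrite sqr_ge0.
(* Products of a centered norm and an approximation error are split by [2 u w <= t u^2 + w^2 / t].
   The choice of [t] keeps the first part below [e / 2], and [dl] is such that
   [(1 / t + 1) dl = e / 2]; the 1 pays for the product of two errors. *)
pose t := e / (2 * (K + 1)).
have t0 : 0 < t by rewrite divr_gt0// mulr_gt0// ltr_wpDl.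
pose dl := e / 2 * (t / (1 + t)).
have t1 : 0 < 1 + t by rewrite addr_gt0.
have dl0 : 0 < dl by rewrite /dl; apply: mulr_gt0; apply: divr_gt0.
have [phi [sphi mphi rL1 rdl]] := simple_approximation sep (measurable_coord 0) L2 dl0.
have [I [s [A [v [mA psiE]]]]] := borel_simpleB m sphi.
pose psi y := phi y - m.
pose n2 y := rnorm (y - m) ^+ 2; pose r2 y := rnorm (y - phi y) ^+ 2.
have n2L1 k : L1 Q (fun x => n2 (x (Posz k))) by exact: (L1_at erg _ (L1_sqnormB L2 m)).
have r2L1 k : L1 Q (fun x => r2 (x (Posz k))) by exact: (L1_at erg (g := r2) _ rL1).
have n2E k : \int[Q]_x n2 (x (Posz k)) = K by exact: (mean_at erg (g := n2) _ (L1_sqnormB L2 m)).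
have r2E k : \int[Q]_x r2 (x (Posz k)) <= dl by rewrite (mean_at erg (g := r2) _ rL1).
pose h k x := t * n2 (x (Posz k)) + (t^-1 + 1) * r2 (x (Posz k)).
have hL1 k : L1 Q (h k) by apply: L1D; apply: L1Z.
have hE k : \int[Q]_x h k x <= e.
  rewrite /h meanD; [|exact: L1Z..]; rewrite !meanZ// n2E.
  have : (t^-1 + 1) * \int[Q]_x r2 (x (Posz k)) <= (t^-1 + 1) * dl.
    by rewrite ler_wpM2l// addr_ge0// invr_ge0 ltW.
  have -> : (t^-1 + 1) * dl = e / 2.
    by rewrite /dl; field; rewrite !gt_eqF.
  have : t * (K + 1) = e / 2 by rewrite /t; field; rewrite gt_eqF// ltr_wpDl.
  lra.
exists (fun x => rank_one (psi (x a%:Z)) (psi (x b%:Z))),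
  (fun x => 2^-1 * (h a x + h b x)); split.
- exists (I * I)%type, [seq (i, j) | i <- s, j <- s],
    (fun p (x : path_space H) => \1_(A p.1) (x a%:Z) * \1_(A p.2) (x b%:Z)),
    (fun p => rank_one (v p.1) (v p.2)), (fun p => rnorm (v p.1) * rnorm (v p.2)).
  split=> [[i j]|[i j] l hl|x] /=.
  + have mB (k : nat) (q : I) : measurable [set x : path_space H | A q (x k%:Z)].
      by have := measurable_coord (k%:Z) measurableT (mA q); rewrite setTI.
    have := integrable_indic Q (measurableI _ _ (mB a i) (mB b j)).
    by congr (L1 Q _); apply/funext => x; rewrite indicI.
  + rewrite ler_norml nuclear_le_rank_one// andbT lerNl.
    exact: (nuclear_le_rank_one _ _ (trace_functional_opp hl)).
  + have sumE (y y' : H) (q q' : seq I) :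
      rank_one (\sum_(i <- q) (\1_(A i) y : R)%:C *: v i)
        (\sum_(j <- q') (\1_(A j) y' : R)%:C *: v j) =
      \sum_(i <- q) \sum_(j <- q') (\1_(A i) y * \1_(A j) y' : R)%:C *: rank_one (v i) (v j).
      have zl u : rank_one (0 : H) u = 0.
        by apply/funext => z; rewrite /rank_one scaler0.
      have zr u : rank_one u (0 : H) = 0.
        by apply/funext => z; rewrite /rank_one ip0r scale0r.
      elim: q => [|i q IH]; first by rewrite !big_nil zl.
      rewrite !big_cons rank_oneDl IH; congr (_ + _).
      elim: q' {IH} => [|j q' IH]; first by rewrite !big_nil zr.
      by rewrite !big_cons rank_oneDr IH rank_one_real.
    by rewrite big_allpairs /psi !psiE sumE.
- by apply: L1Z; apply: L1D.
- rewrite meanZ; last exact: L1D.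
  by rewrite meanD//; have := hE a; have := hE b; lra.
- move=> l x hl.
  have lD := trace_functional_add _ _ hl.
  pose ya := x a%:Z; pose yb := x b%:Z.
  have -> : lag_product x - rank_one (psi ya) (psi yb) =
      rank_one (ya - phi ya) (yb - m) + rank_one (psi ya) (yb - phi yb).
    rewrite /lag_product; apply/funext => z; rewrite /rank_one /psi.
    rewrite -[LHS]/(ip z (yb - m) *: (ya - m) - ip z (phi yb - m) *: (phi ya - m)).
    rewrite -[RHS]/(ip z (yb - m) *: (ya - phi ya) + ip z (yb - phi yb) *: (phi ya - m)).
    have -> : yb - phi yb = (yb - m) + (-1) *: (phi yb - m).
      by rewrite scaleN1r opprB addrA subrK.
    have -> : ya - phi ya = (ya - m) - (phi ya - m) by rewrite opprB addrA subrK.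
    move: (yb - m) (phi yb - m) (ya - m) (phi ya - m) => p q p' q'.
    rewrite ipDr ipZr rmorphN rmorph1 mulN1r scalerBr scalerDl scaleNr.
    by rewrite addrA subrK.
  rewrite lD.
  have h1 := nuclear_le_rank_one (ya - phi ya) (yb - m) hl.
  have h2 := nuclear_le_rank_one (psi ya) (yb - phi yb) hl.
  have h3 : rnorm (psi ya) <= rnorm (ya - m) + rnorm (ya - phi ya).
    rewrite [leLHS](_ : _ = rnorm ((ya - m) - (ya - phi ya))); first exact: rnormB.
    by rewrite opprB [in RHS]addrC addrA subrK.
  rewrite /h /n2 /r2 -/ya -/yb.
  move: (rnorm_ge0 (ya - phi ya)) (rnorm_ge0 (yb - phi yb)).
  move: (rnorm_ge0 (ya - m)) (rnorm_ge0 (yb - m)).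
  move: h1 h2 h3.
  move: (rnorm (ya - phi ya)) (rnorm (yb - phi yb)) (rnorm (ya - m)) (rnorm (yb - m)).
  move: (rnorm (psi ya)) => pa ra rb na nb h1 h2 h3 na0 nb0 ra0 rb0.
  have amgm u w : 2 * (u * w) <= t * u ^+ 2 + t^-1 * w ^+ 2.
    rewrite -(ler_pM2l t0) mulrDr mulVKf ?gt_eqF//.
    by have := sqr_ge0 (t * u - w); lra.
  have := ler_wpM2r rb0 h3; have := amgm nb ra; have := amgm na rb.
  have := sqr_ge0 (ra - rb); lra.
Qed.

Lemma lag_product_birkhoff :
  {ae Q, forall x, forall e, 0 < e -> exists N, forall n, (N <= n)%N ->
     nuclear_le (average (@Defs.shift R H) lag_product n x - C) e}.
Proof.
apply: (vector_birkhoff erg (L := trace_functional)).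
- by move=> l u v; exact: trace_functional_add.
- by move=> l r v; exact: trace_functional_scale.
- by move=> l; exact: trace_functional_opp.
- by move=> l hl; exact: functional_lag_product.
- exact: lag_product_approximation.
Qed.

End PathCovariance.

(** * From the process to path space *)

Section ProcessLaw.
Context {R : realType} {H : hilbertType R} {d : measure_display}
  {Omega : measurableType d} (P : probability Omega R) (X : int -> Omega -> H).
Hypothesis hX : is_process X.

(** Offset 0 transports almost sure statements; other offsets express expectations at arbitrary
    times through stationarity. *)
Definition trajectory (s : int) (w : Omega) : path_space H := fun t => X (t + s) w.

Lemma measurable_trajectory s : measurable_fun setT (trajectory s).
Proof.
apply: (@measurability _ _ _ (path_space H) setT (trajectory s) (@cylinders R H) erefl).
move=> _ [_ [t [B mB ->]] <-].
exact: hX (t + s) measurableT B mB.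
Qed.

(** [law] is a bare set function; measurability of trajectories makes it a probability, as the
    ergodic lemmas require. *)
Definition process_law : probability (path_space H) R :=
  distribution P (mfun_Sub (mem_set (measurable_trajectory 0))).

Lemma process_lawE A : process_law A = law P X A.
Proof.
rewrite -[LHS]/(P (trajectory 0 @^-1` A)) (_ : trajectory 0 = fun w t => X t w)//.
by apply/funext => w; apply/funext => t; rewrite /trajectory addr0.
Qed.

Hypothesis hstat : strictly_stationary P X.

Lemma process_law_stationary s A : measurable A ->
  process_law A = P (trajectory s @^-1` A).
Proof. by move=> mA; rewrite process_lawE -(hstat s mA). Qed.

Lemma mean_trajectory s (f : path_space H -> R) : measurable_fun setT f ->
  L1 process_law f -> \int[P]_w f (trajectory s w) = \int[process_law]_x f x.
Proof.
move=> mf L1f; have hs := process_law_stationary s.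
rewrite (mean_image (measurable_trajectory s) hs)//.
exact: (L1_image (measurable_trajectory s) hs mf).1.
Qed.

End ProcessLaw.

(** * Identification of the weak covariance with [cov_op] *)

Section CovarianceOperator.
Context {R : realType} {H : hilbertType R} {d : measure_display}
  {Omega : measurableType d} (P : probability Omega R) (X : int -> Omega -> H).
Hypothesis hX : is_process X.
Hypothesis hstat : strictly_stationary P X.
Local Notation Q := (process_law P hX).
Hypothesis erg : ergodic Q (@Defs.shift R H).
Hypothesis L2 : L1 Q (fun x => rnorm (x 0) ^+ 2).
Variables (m : H) (a b : nat).
Hypothesis hm : forall z, \int[Q]_x rip (x 0 - m) z = 0.

Lemma cexpectation_ip (t : int) (z : H) :
  cexpectation P (fun w => ip (X t w) z) = ip m z.
Proof.
have key u : \int[P]_w rip (X t w) u = rip m u.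
  have h0 : L1 Q (fun x => rip (x 0) u).
    by have := L1_ripB L2 0 u; congr (L1 Q _); apply/funext => x; rewrite subr0.
  have mh : measurable_fun setT (fun x : path_space H => rip (x 0) u) by exact: L1_measurable h0.
  have := hm u; under eq_Rintegral do rewrite ripBl.
  rewrite meanB ?mean_cst//; last exact: L1_cst.
  move=> /eqP; rewrite subr_eq0 -(mean_trajectory hstat t mh h0) => /eqP<-.
  by apply: eq_Rintegral => w _; rewrite /trajectory add0r.
apply/eqP; rewrite /cexpectation eq_complex/=; apply/andP; split; apply/eqP.
  exact: key.
rewrite Im_ip -key; apply: eq_Rintegral => w _; exact: Im_ip.
Qed.

Lemma ccovariance_ip (y z : H) :
  ccovariance P (fun w => ip (X (a%:Z - b%:Z) w) z) (fun w => ip (X 0 w) y) =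
  (\int[Q]_x rip (lag_product m a b x y) z) +i*
  (\int[Q]_x rip (lag_product m a b x y) ('i%C *: z)).
Proof.
rewrite /ccovariance !cexpectation_ip.
have prodE w : (ip (X (a%:Z - b%:Z) w) z - ip m z) * Num.conj (ip (X 0 w) y - ip m y) =
    ip (rank_one (X (a%:Z - b%:Z) w - m) (X 0 w - m) y) z.
  rewrite /rank_one ipZl mulrC -!(mulN1r (ip m _)) -!(ipZl (- 1) m) !scaleN1r -!ipDl.
  by rewrite -ip_conjC.
under eq_fun do rewrite prodE.
have key u : \int[P]_w rip (rank_one (X (a%:Z - b%:Z) w - m) (X 0 w - m) y) u =
    \int[Q]_x rip (lag_product m a b x y) u.
  (* The offset [- b] sends the path times [a] and [b] to the process times [a - b] and [0]. *)
  rewrite -(mean_trajectory hstat (- b%:Z) (measurable_lag_product _ _ _ _ _)); last first.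
    exact: L1_lag_product.
  by apply: eq_Rintegral => w _; rewrite /lag_product /trajectory subrr.
rewrite /cexpectation -!key; congr (_ +i* _).
by apply: eq_Rintegral => w _; rewrite Im_ip.
Qed.

(** [C] itself witnesses existence, so [cov_op] is not its default value, and the defining identity
    determines the operator. *)
Lemma cov_op_path (C : H -> H) : bounded_op C ->
  (forall y z, rip (C y) z = \int[Q]_x rip (lag_product m a b x y) z) ->
  cov_op P (X (a%:Z - b%:Z)) (X 0) = C.
Proof.
move=> bC hC.
have ipC y x : ip (C y) x = ccovariance P (fun w => ip (X (a%:Z - b%:Z) w) x)
    (fun w => ip (X 0 w) y).
  rewrite ccovariance_ip; apply/eqP; rewrite eq_complex/= Im_ip -!hC.
  by rewrite !eqxx.
have exC : exists C, is_cov_op P (X (a%:Z - b%:Z)) (X 0) C by exists C; split.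
have [_ covE] := xgetPex 0 exC.
by apply/funext => y; apply: rip_eq => z; rewrite ![rip z _]ripC /rip ipC -covE.
Qed.

End CovarianceOperator.

Theorem theorem1p1 (R : realType) (H0 : hilbertType R)
    (hsep : separable H0)
    (d : measure_display) (Omega : measurableType d) (P : probability Omega R)
    (X : int -> Omega -> H0)
    (hX : is_process X)
    (hstat : strictly_stationary P X)
    (herg : ergodic_process P X)
    (hL2 : (\int[P]_w (rnorm (X 0 w) ^+ 2)%:E < +oo)%E)
    (h : int) :
  {ae P, forall w : Omega,
     cvg_S1 (fun n : nat => empirical_autocov X h n w) (cov_op P (X h) (X 0))}.
Proof.
(* The positive and negative parts of [h]. *)
have [a [b [-> ab0]]] : exists a b : nat, h = a%:Z - b%:Z /\ (a = 0%N \/ b = 0%N).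
  case: h => k; first by exists k, 0%N; rewrite subr0; split=> //; right.
  by exists 0%N, k.+1; rewrite sub0r NegzE; split=> //; left.
pose Q := process_law P hX.
have Qtraj s := process_law_stationary hX hstat s.
have erg : ergodic Q (@Defs.shift R H0).
  have QE := process_lawE P hX; have [[mS presS] indS] := herg.
  split; [split=> // A mA | move=> A mA SA].
    by rewrite !QE presS.
  by have [A0|A1] := indS A mA SA; [left|right]; rewrite QE.
have L2 : L1 Q (fun x => rnorm (x 0) ^+ 2).
  have mf : measurable_fun setT (fun x : path_space H0 => rnorm (x 0) ^+ 2).
    apply: (measurable_at (g := fun y => rnorm y ^+ 2)); apply: measurable_funX.
    have := @borel_measurable_rnormB R H0 0.
    by congr (measurable_fun _ _); apply/funext => y; rewrite subr0.
  apply/(L1_image (measurable_trajectory hX 0) (Qtraj 0) mf).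
  apply/integrableP; split.
    by apply/measurable_EFinP; apply: measurableT_comp mf (measurable_trajectory hX 0).
  rewrite (eq_integral (fun w => (rnorm (X 0 w) ^+ 2)%:E))// => w _ /=.
  by rewrite /trajectory addr0 ger0_norm ?sqr_ge0.
have [m hm] := path_mean L2.
have [C [bC hC]] := path_covariance erg L2 m a b.
rewrite (cov_op_path hstat erg L2 hm bC hC).
have ae1 := path_mean_birkhoff erg hsep L2 hm.
have ae2 := lag_product_birkhoff erg hsep L2 hC.
have nL1 (k : nat) : L1 Q (fun x => rnorm (x k%:Z - m)).
  exact: (L1_at erg (g := fun y => rnorm (y - m)) _ (L1_normB L2 m)).
have ae3 := ae_foralln (fun k => birkhoff erg (nL1 k)).
have ae_traj := @ae_image _ _ _ P _ _ Q _ (measurable_trajectory hX 0) (Qtraj 0).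
apply: filterS3 (ae_traj _ ae1) (ae_traj _ ae2) (ae_traj _ ae3) => w w1 w2 w3.
have iterE k t : iter k (@Defs.shift R H0) (trajectory X 0 w) t = X (t + k%:Z) w.
  by rewrite iter_shift /trajectory addr0.
pose y j := X j%:Z w - m.
have yE j (k : nat) : iter j (@Defs.shift R H0) (trajectory X 0 w) k%:Z - m = y (j + k)%N.
  by rewrite iterE -PoszD addnC.
(* The empirical mean minus [m]. Centering is unaffected by subtracting [m] first, so the centered
   values are [y k - dl n] with [dl n] tending to 0. *)
pose dl n := average (@Defs.shift R H0) (fun x : path_space H0 => x 0 - m) n (trajectory X 0 w).
have dlE n : (0 < n)%N -> forall k, centered X n k w = y k - dl n.
  move=> n0 k; rewrite /centered /y -addrA; congr (_ + _); rewrite -opprD; congr (- _).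
  have -> : dl n = (n%:R^-1 : R)%:C *: \sum_(1 <= j < n.+1) (X j%:Z w - m).
    by congr (_ *: _); apply: eq_bigr => j _; rewrite iterE add0r.
  rewrite sumrB sumr_const_nat subSS subn0 scalerBr addrC.
  have -> : (n%:R^-1 : R)%:C = n%:R^-1 by rewrite fmorphV rmorph_nat.
  have -> : n%:R^-1 *: (m *+ n) = m.
    by rewrite -[m *+ n]scaler_nat scalerA mulVf ?scale1r// pnatr_eq0 -lt0n.
  by rewrite subrK.
have scE n : (n%:R^-1 : R[i]) = (n%:R^-1 : R)%:C by rewrite fmorphV rmorph_nat.
apply: cvg_S1_nuclear => //.
- move=> n; apply: bounded_opZ; apply: bounded_op_sum => k; apply: bounded_op_sum => k'.
  exact: rank_one_bounded.
- move=> n; eexists; rewrite /empirical_autocov scE; apply: nuclear_leZ.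
  apply: nuclear_le_sum => k; apply: nuclear_le_sum => k'.
  exact: nuclear_le_rank_one.
- have bound (k : nat) : (forall e, 0 < e -> exists N, forall n, (N <= n)%N ->
     `|n%:R^-1 * (\sum_(1 <= j < n.+1)
          rnorm (iter j (@Defs.shift R H0) (trajectory X 0 w) k%:Z - m)) - \int[Q]_x rnorm (x k%:Z - m)| <= e) ->
     exists N, forall p, (N <= p)%N ->
     p%:R^-1 * (\sum_(1 <= j < p.+1) rnorm (y (j + k)%N)) <= \int[Q]_x rnorm (x k%:Z - m) + 1.
    move=> /(_ 1 ltr01)[N hN]; exists N => p /hN.
    under eq_bigr do rewrite yE.
    by rewrite ler_norml lerBlDl => /andP[_].
  have Ige0 (k : nat) : 0 <= \int[Q]_x rnorm (x k%:Z - m).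
    by apply: mean_ge0 => x; exact: rnorm_ge0.
  pose B := \int[Q]_x rnorm (x a%:Z - m) + \int[Q]_x rnorm (x b%:Z - m) + 1.
  have [Na ha] := bound a (w3 a); have [Nb hb] := bound b (w3 b).
  have ha' : exists N, forall p, (N <= p)%N ->
     p%:R^-1 * (\sum_(1 <= j < p.+1) rnorm (y (j + a)%N)) <= B.
    by exists Na => p /ha; rewrite /B; have := Ige0 b; lra.
  have hb' : exists N, forall p, (N <= p)%N ->
     p%:R^-1 * (\sum_(1 <= j < p.+1) rnorm (y (j + b)%N)) <= B.
    by exists Nb => p /hb; rewrite /B; have := Ige0 a; lra.
  have hA e : 0 < e -> exists N, forall p, (N <= p)%N -> nuclear_le
     ((p%:R^-1 : R)%:C *: (\sum_(1 <= j < p.+1) rank_one (y (j + a)%N) (y (j + b)%N)) - C) e.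
    move=> /w2[N hN]; exists N => p /hN; rewrite /average.
    under eq_bigr do rewrite /lag_product !yE.
    by [].
  move=> e e0; have CK := covariance_nuclear erg L2 hC.
  (* The diagonal has [maxn a b] terms fewer than [n]; [N.+1] ensures [0 < n], as [dlE] requires. *)
  have [N hN] := centered_sum_nuclear (maxn a b) w1 ha' hb' CK hA e0; exists N.+1 => n Nn.
  rewrite /empirical_autocov scE sum_diagonal//.
  under eq_bigr do rewrite !dlE ?(leq_trans _ Nn)//.
  by apply: hN; exact: ltnW.
Qed.
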